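(* Let $N$ be a positive integer, let $\mathbf p=(p_1,p_2,\dots,p_N)$ with $p_i\in(1,\infty)$, and suppose that $\sum_{i=1}^N\frac1{p_i}<1$. Then for any $\lambda>0$ there is a constant $C_{N,\mathbf p,\lambda}$, depending only on $N,\mathbf p,\lambda$, such that $$ \|F\|_{L^\infty(\mathbb R^N)}\le C_{N,\mathbf p,\lambda}\max\left\{1,\sup_{r\ge2}\frac{\|F\|_{L^r(\mathbb R^N)}}{(r\log r)^\lambda}\right\}\bigl[\log\mathcal N_{\mathbf p}(F)\,\log\log\mathcal N_{\mathbf p}(F)\bigr]^\lambda $$ for any function $F$ on $\mathbb R^N$ such that all the quantities on the right-hand side are well-defined and finite, where $$ \mathcal N_{\mathbf p}(F)=\sum_{i=1}^N\bigl(\|F\|_{L^{p_i}(\mathbb R^N)}+\|\partial_iF\|_{L^{p_i}(\mathbb R^N)}\bigr)+e^3 . $$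
   Context: $\partial_iF$ denotes the weak partial derivative of $F$ in the $i$-th coordinate direction. The supremum is over real $r\in[2,\infty)$. *)

(* Defs.v *)
From HB Require Import structures.
From mathcomp Require Import all_boot all_order all_algebra.
From mathcomp Require Import all_classical all_reals all_analysis.

Set Implicit Arguments.
Unset Strict Implicit.
Unset Printing Implicit Defensive.
Import Order.TTheory GRing.Theory Num.Theory.
Import numFieldNormedType.Exports.
Local Open Scope classical_set_scope.
Local Open Scope ring_scope.

(* The product sigma-algebra on row vectors, generated by the coordinates as
   the library does for n.-tuple T; on 'rV[R]_n, R : realType, it is the Borel
   sigma-algebra. *)
Section measurable_rV.
Context {d} {T : measurableType d}.
Variable n : nat.

Let coors : 'I_n -> 'rV[T]_n -> T := fun i x => x ord0 i.

Let rV_set0 : g_sigma_preimage coors set0.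
Proof. exact: sigma_algebra0. Qed.

Let rV_setC A : g_sigma_preimage coors A -> g_sigma_preimage coors (~` A).
Proof. exact: sigma_algebraC. Qed.

Let rV_bigcup (F : (set 'rV[T]_n)^nat) :
  (forall i, g_sigma_preimage coors (F i)) ->
  g_sigma_preimage coors (\bigcup_i (F i)).
Proof. exact: sigma_algebra_bigcup. Qed.

HB.instance Definition _ := @isMeasurable.Build (measure_tuple_display d)
  'rV[T]_n (g_sigma_preimage coors) rV_set0 rV_setC rV_bigcup.

End measurable_rV.

Lemma measurable_coord d (T : measurableType d) n (i : 'I_n) :
  measurable_fun [set: 'rV[T]_n] (fun x : 'rV[T]_n => x ord0 i).
Proof.
move=> _ Y mY; rewrite setTI; apply: sub_sigma_algebra => /=.
rewrite -bigcup_seq/=; exists i => /=; first by rewrite mem_index_enum.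
by exists Y => //; rewrite setTI.
Qed.

Lemma measurable_fun_coordP d1 d2 (T1 : measurableType d1)
    (T2 : measurableType d2) n (f : T1 -> 'rV[T2]_n) :
  measurable_fun [set: T1] f <->
  forall i, measurable_fun [set: T1] (fun x => f x ord0 i).
Proof.
split=> [mf i|mf].
  exact: (measurableT_comp (measurable_coord i) mf).
move=> _ A mA; rewrite setTI.
have : preimage_set_system [set: T1] f
    (g_sigma_preimage (fun i (x : 'rV[T2]_n) => x ord0 i)) (f @^-1` A).
  by exists A => //; rewrite setTI.
rewrite -g_sigma_preimage_comp; apply: smallest_sub.
  exact: sigma_algebra_measurable.
rewrite -bigcup_seq => B [i _] [C mC <-].
exact: mf.
Qed.

Section rV_cons.
Context {R : realType} {n : nat}.

Definition rV_cons (p : R * 'rV[R]_n) : 'rV[R]_n.+1 := row_mx p.1%:M p.2.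

Definition rV_uncons (x : 'rV[R]_n.+1) : R * 'rV[R]_n :=
  (x ord0 ord0, \row_j x ord0 (lift ord0 j)).

Lemma rV_cons0 p : rV_cons p ord0 ord0 = p.1.
Proof.
rewrite /rV_cons (_ : ord0 = lshift n (ord0 : 'I_1)); last exact/val_inj.
by rewrite (@row_mxEl R 1 1 n) mxE.
Qed.

Lemma rV_consS p j : rV_cons p ord0 (lift ord0 j) = p.2 ord0 j.
Proof.
rewrite /rV_cons (_ : lift ord0 j = rshift 1 j); last exact/val_inj.
by rewrite (@row_mxEr R 1 1 n).
Qed.

Lemma rV_consK : cancel rV_cons rV_uncons.
Proof.
move=> [x y]; rewrite /rV_uncons rV_cons0; congr pair.
by apply/rowP => j; rewrite mxE rV_consS.
Qed.

Lemma measurable_rV_cons : measurable_fun setT rV_cons.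
Proof.
apply/measurable_fun_coordP => i; case: (unliftP ord0 i) => [j|] ->.
  under eq_fun do rewrite rV_consS.
  exact: (measurableT_comp (measurable_coord j) measurable_snd).
under eq_fun do rewrite rV_cons0.
exact: measurable_fst.
Qed.

Lemma measurable_rV_uncons : measurable_fun setT rV_uncons.
Proof.
apply/measurable_fun_pairP; split; first exact: measurable_coord.
apply/measurable_fun_coordP => j /=.
under eq_fun do rewrite mxE.
exact: measurable_coord.
Qed.

End rV_cons.

Section lebesgue_step.
Context {R : realType} {n : nat}.
Variable m : {sigma_finite_measure set 'rV[R]_n -> \bar R}.

Definition lebesgue_step : set 'rV[R]_n.+1 -> \bar R :=
  pushforward (lebesgue_measure \x m)%E rV_cons.

Let step0 : lebesgue_step set0 = 0%E.
Proof. by rewrite /lebesgue_step /pushforward preimage_set0 measure0. Qed.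

Let step_ge0 A : (0 <= lebesgue_step A)%E.
Proof. by rewrite /lebesgue_step /pushforward measure_ge0. Qed.

Let step_sigma_additive : semi_sigma_additive lebesgue_step.
Proof.
exact: (@measure_semi_sigma_additive _ _ _
  (measure_function_pushforward__canonical__measure_function_Measure
    (lebesgue_measure \x m)%E measurable_rV_cons)).
Qed.

HB.instance Definition _ := isMeasure.Build _ _ _ lebesgue_step
  step0 step_ge0 step_sigma_additive.

Let step_sigma_finite : sigma_finite setT lebesgue_step.
Proof.
have /sigma_finiteP[F [FT ndF Foo]] := sigma_finiteT (@lebesgue_measure R).
have /sigma_finiteP[G [GT ndG Goo]] := sigma_finiteT m.
exists (fun k => rV_uncons @^-1` (F k `*` G k)).
  rewrite -preimage_bigcup; apply/esym/seteqP; split=> // x _ /=.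
  have : [set: R] (rV_uncons x).1 by [].
  have : [set: 'rV[R]_n] (rV_uncons x).2 by [].
  rewrite FT GT => -[k _ Gk] [l _ Fl]; exists (maxn k l) => //; split.
    by move: Fl; exact/subsetPset/ndF/leq_maxr.
  by move: Gk; exact/subsetPset/ndG/leq_maxl.
move=> k; have [mF Fkoo] := Foo k; have [mG Gkoo] := Goo k; split.
  by rewrite -[X in measurable X]setTI; apply: measurable_rV_uncons => //;
    exact: measurableX.
rewrite /lebesgue_step /pushforward -comp_preimage.
rewrite (_ : rV_uncons \o rV_cons = id); last exact/funext/rV_consK.
by rewrite preimage_id product_measure1E// lte_mul_pinfty// ge0_fin_numE.
Qed.

HB.instance Definition _ := Measure_isSigmaFinite.Build _ _ _ lebesgue_step
  step_sigma_finite.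

End lebesgue_step.

(* Lebesgue measure on R^n, as the image of lebesgue_measure \x lebesgue_rV n
   under R * R^n -> R^n.+1; R^0 is a point of mass 1. *)
Fixpoint lebesgue_rV (R : realType) (n : nat) :
    {sigma_finite_measure set 'rV[R]_n -> \bar R} :=
  if n is n'.+1 then lebesgue_step (lebesgue_rV R n') else \d_(0 : 'rV[R]_0).

Lemma measurable_box (R : realType) n (A : 'I_n -> set R) :
  (forall i, measurable (A i)) ->
  measurable [set x : 'rV[R]_n | forall i, A i (x ord0 i)].
Proof.
move=> mA.
rewrite (_ : [set _ | _] = \bigcap_(i in [set: 'I_n])
    ((fun x : 'rV[R]_n => x ord0 i) @^-1` A i)); last first.
  by apply/seteqP; split => [x h i _|x h i]; [exact: h|exact: (h i I)].
apply: fin_bigcap_measurable; first exact: finite_finset.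
by move=> i _; rewrite -[X in measurable X]setTI; apply: measurable_coord.
Qed.

Lemma lebesgue_rV_box (R : realType) n (A : 'I_n -> set R) :
  (forall i, measurable (A i)) ->
  (lebesgue_rV R n [set x : 'rV[R]_n | forall i, A i (x ord0 i)]
   = \big[mule/1]_(i < n) lebesgue_measure (A i))%E.
Proof.
elim: n A => [|n IH] A mA.
  by rewrite big_ord0 /= diracE mem_set//= => -[].
rewrite big_ord_recl -IH; last by move=> i; exact: mA.
have mA' := @measurable_box R n (fun i => A (lift ord0 i)) (fun i => mA _).
transitivity ((@lebesgue_measure R \x lebesgue_rV R n)%E
  (A ord0 `*`
    [set x : 'rV[R]_n | forall i, A (lift ord0 i) (x ord0 i)])); last first.
  by rewrite (@product_measure1E _ _ (measurableTypeR R) _ R lebesgue_measure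
    (lebesgue_rV R n) _ _ (mA ord0) mA').
rewrite [LHS]/= /lebesgue_step /pushforward; congr product_measure1.
apply/seteqP; split => [p h|p [h1 h2] i] /=.
  split; first by move: (h ord0); rewrite rV_cons0.
  by move=> i /=; move: (h (lift ord0 i)); rewrite rV_consS.
by case: (unliftP ord0 i) => [j|] ->; rewrite ?rV_cons0 ?rV_consS//; exact: h2.
Qed.

Section weak_derivative.
Context {R : realType} {n : nat}.
Implicit Types (F G phi : 'rV[R]_n -> R) (i : 'I_n).

Local Notation mu := (lebesgue_rV R n).

Definition pderiv i phi : 'rV[R]_n -> R :=
  fun x => 'D_(delta_mx ord0 i) phi x.

(* For s = [:: i_1; ...; i_k], the iterated derivative d_{i_1} ... d_{i_k}. *)
Definition iter_pderiv (s : seq 'I_n) phi : 'rV[R]_n -> R :=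
  foldr pderiv phi s.

Definition smooth phi := forall s,
  continuous (iter_pderiv s phi) /\
  forall i x, derivable (iter_pderiv s phi) x (delta_mx ord0 i).

Definition test_function phi :=
  smooth phi /\ compact (closure [set x | phi x != 0]).

(* The library integral of a function that is a.e. equal to a Borel function
   is the integral of that Borel function, so the norms and integrals below
   are the Lebesgue ones although 'rV[R]_n carries the Borel sigma-algebra. *)
Definition lebesgue_measurable F := exists2 G : 'rV[R]_n -> R,
  measurable_fun [set: 'rV[R]_n] G & {ae mu, forall x, F x = G x}.

Definition loc_integrable F := lebesgue_measurable F /\
  forall K : set 'rV[R]_n, compact K -> (\int[mu]_(x in K) `|F x|%:E < +oo)%E.

Definition weak_pderiv i F G := [/\ loc_integrable F, loc_integrable G &
  forall phi, test_function phi ->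
    (\int[mu]_x (F x * pderiv i phi x)%:E = - \int[mu]_x (G x * phi x)%:E)%E].

Local Open Scope ereal_scope.

(* The library's Lnorm at exponent p%:E, resp. +oo, is the L^p norm, resp. the
   essential supremum of the absolute value. *)
Definition normL (p : \bar R) F : \bar R := Lnorm mu p (EFin \o F).

(* N_p(F), where G i stands for the weak derivative of F along i. *)
Definition sobolev_sum (p : 'I_n -> R) F (G : 'I_n -> 'rV[R]_n -> R) : \bar R :=
  \sum_(i < n) (normL (p i)%:E F + normL (p i)%:E (G i)) + (expR 3)%:E.

Definition sup_normL (lambda : R) F : \bar R :=
  ereal_sup [set normL r%:E F * (((r * ln r) `^ lambda)^-1)%:E
            | r in [set r : R | (2 <= r)%R]].

End weak_derivative.

(* Main.v *)
Require Import Defs.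
From mathcomp Require Import all_boot all_order all_algebra.
From mathcomp Require Import ring lra.
From mathcomp Require Import all_classical all_reals all_analysis.
From mathcomp Require Import measurable_realfun ess_sup_inf.
Import Order.TTheory GRing.Theory Num.Theory.
Import numFieldNormedType.Exports.
Local Open Scope classical_set_scope.
Local Open Scope ring_scope.

(** A function with one weak derivative in L^(p_i) along each axis, where
    sum 1/p_i < 1, satisfies an anisotropic Morrey estimate, and the logarithm
    comes from balancing that estimate against the L^r norm.

    Put g = (1 - sum 1/p_i) / N and a_i = 1/p_i + g, so that g > 0 and the a_i
    sum to 1.  Let A_d(c) be the average of F against a smooth kernel that
    lives on the box centred at c with half-sides d^(a_i), a box of volume
    comparable to d.  Passing from d to d/2 one coordinate at a time, the
    difference of two successive kernels is the i-th partial derivative of a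
    test function supported in the same box and of size O(d^(a_i - 1)).  The
    weak derivative and Hoelder's inequality therefore give
      |A_d(c) - A_(d/2)(c)| <= const * d^g * sum_i ||d_i F||_(p_i),
    the exponent being a_i - 1 + (1 - 1/p_i) = g
    ([primitive_pairing], [average_osc], [average_halve]).  Summing the
    geometric series bounds every A_(d/2^k)(c), uniformly in k and c, by
      const * (d^(-1/r) ||F||_r + d^g * sum_i ||d_i F||_(p_i))
    where the first term is Hoelder's bound for A_d(c) ([average_bound]).

    Uniform bounds on averages at arbitrarily small scales bound F almost
    everywhere ([ae_le_double]).  Instead of differentiating integrals, this
    uses that the kernels at a fixed scale, translated along a grid, form a
    partition of unity: summing those that touch a closed bounded set K gives
    functions converging pointwise to the indicator of K, so the integral of F
    over K is at most M times the measure of K ([closed_average]); inner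
    regularity ([closed_subset_gt0]) then forbids F > 2 M on a set of positive
    measure.

    Finally, with S = N_p(F), take d = S^(-1/g) and r = ln S >= 3.  Then
    d^g S = 1 and d^(-1/r) = e^(1/g), so F is bounded by a constant times
    1 + ||F||_(ln S), and ||F||_(ln S) is at most the supremum in the
    hypothesis times (ln S ln ln S)^lambda, a power that is at least 1. *)

Set Implicit Arguments.
Unset Strict Implicit.
Unset Printing Implicit Defensive.

(** * Smooth functions of one real variable *)

Section smooth_line.
Context {R : realType}.
Implicit Types (f g : R -> R) (Q : {poly R}).

(** Stated by recursion on the derivative, so that closure under products and
    inverses is a one-step induction through Leibniz' rule. *)
Fixpoint Ck n g : Prop :=
  if n is n'.+1 then (forall x : R, derivable g x (1 : R)) /\ Ck n' (derive1 g)
  else continuous g.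

Definition smooth1 g := forall n, Ck n g.

Lemma is_derive_derive1 f f' :
  (forall x : R, is_derive x (1 : R) f (f' x)) -> derive1 f = f'.
Proof. by move=> df; apply/funext => x; rewrite derive1E; case: (df x). Qed.

Lemma derivable_continuous f :
  (forall x : R, derivable f x (1 : R)) -> continuous f.
Proof.
by move=> df x; apply: differentiable_continuous; apply/derivable1_diffP.
Qed.

Lemma CkS n g g' :
  (forall x : R, is_derive x (1 : R) g (g' x)) -> Ck n g' -> Ck n.+1 g.
Proof.
move=> dg cg'; split; last by rewrite (is_derive_derive1 dg).
by move=> x; case: (dg x).
Qed.

Lemma CkSP n g :
  Ck n.+1 g -> (forall x : R, is_derive x (1 : R) g (derive1 g x)).
Proof. by move=> [dg _] x; rewrite derive1E; apply/derivableP. Qed.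

Lemma CkW n g : Ck n.+1 g -> Ck n g.
Proof.
elim: n g => [|n IH] g; first by move=> [dg _]; exact: derivable_continuous.
by move=> [dg cg]; split=> //; exact: IH.
Qed.

Lemma CkD n f g : Ck n f -> Ck n g -> Ck n (fun x => f x + g x).
Proof.
elim: n f g => [|n IH] f g cf cg.
  by move=> x; apply: cvgD; [exact: cf|exact: cg].
apply: (@CkS _ _ (fun x => derive1 f x + derive1 g x)); last first.
  by case: cf cg => _ ? [_ ?]; exact: IH.
by move=> x; have := CkSP cf x; have := CkSP cg x => ? ?; exact: is_deriveD.
Qed.

Lemma CkM n f g : Ck n f -> Ck n g -> Ck n (fun x => f x * g x).
Proof.
elim: n f g => [|n IH] f g cf cg.
  by move=> x; apply: cvgM; [exact: cf|exact: cg].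
apply: (@CkS _ _ (fun x => f x * derive1 g x + g x * derive1 f x)).
  by move=> x; have := CkSP cf x; have := CkSP cg x => ? ?; exact: is_deriveM.
by apply: CkD; apply: IH => //; [exact: CkW|case: cg|exact: CkW|case: cf].
Qed.

Lemma Ck_cst n c : Ck n (fun=> c : R).
Proof.
elim: n c => [|n IH] c; first exact: cst_continuous.
by apply: (@CkS _ _ (fun=> 0)) => // x; exact: is_derive_cst.
Qed.

Lemma Ck_id n : Ck n (@id R).
Proof.
case: n => [|n]; first by move=> x; exact: cvg_id.
by apply: (@CkS _ _ (fun=> 1)); last exact: Ck_cst.
Qed.

Lemma CkV n f : (forall x, f x != 0) -> Ck n f -> Ck n (fun x => (f x)^-1).
Proof.
move=> f0; elim: n f f0 => [|n IH] f f0 cf.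
  by move=> x; apply: cvgV => //; exact: cf.
apply: (@CkS _ _ (fun x => (-1) * (((f x)^-1 * (f x)^-1) * derive1 f x))).
  move=> x; have df := CkSP cf x.
  have dV := @is_deriveV R f x _ 1 (f0 x) df.
  apply: (is_derive_eq dV).
  by rewrite /GRing.scale/= mulN1r mulNr -expr2 exprVn.
apply: CkM; first exact: Ck_cst.
by apply: CkM; [apply: CkM; apply: IH => //; exact: CkW|case: cf].
Qed.

Lemma Ck_affine n f a b : Ck n f -> Ck n (fun x => f (a * x + b)).
Proof.
elim: n f => [|n IH] f cf.
  move=> x; apply: (continuous_comp (f := fun x => a * x + b)); last exact: cf.
  by apply: cvgD; [apply: cvgM; [exact: cvg_cst|exact: cvg_id]|exact: cvg_cst].
apply: (@CkS _ _ (fun x => derive1 f (a * x + b) * a)).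
  move=> x; apply: (@is_derive1_comp _ f (fun x => a * x + b)).
    exact: CkSP cf _.
  apply: is_derive_eq.
  by rewrite /GRing.scale/= mulr1 addr0.
by apply: CkM; [apply: IH; case: cf|exact: Ck_cst].
Qed.

Lemma smooth1_derive g : smooth1 g -> smooth1 (derive1 g).
Proof. by move=> sg n; case: (sg n.+1). Qed.

Lemma smooth1_continuous g : smooth1 g -> continuous g.
Proof. by move/(_ 0). Qed.

Lemma smooth1_derivable g x : smooth1 g -> derivable g x (1 : R).
Proof. by move/(_ 1) => [+ _]; exact. Qed.

(** Q(1/t) exp(-1/t), extended by 0 to t <= 0.  The whole family is needed
    because it is stable under differentiation, which replaces Q by
    X^2 (Q - Q'), and under division by t, which replaces Q by X Q. *)
Definition flat Q (t : R) : R :=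
  if t <= 0 then 0 else Q.[t^-1] * expR (- t^-1).

(** The exponential series gives s^(i+1) <= (i+1)! exp s for s = 1/t, that is
    s^i exp(-s) <= (i+1)! t, monomial by monomial. *)
Lemma flat_bound Q : exists2 K, 0 <= K & forall t, `|flat Q t| <= K * `|t|.
Proof.
exists (\sum_(i < size Q) `|Q`_i| * i.+1`!%:R).
  by apply: sumr_ge0 => i _; exact: mulr_ge0.
move=> t; rewrite /flat; case: ifPn => [_|].
  by rewrite normr0 mulr_ge0//; apply: sumr_ge0 => i _; exact: mulr_ge0.
rewrite -ltNge => t0; have s0 : 0 < t^-1 by rewrite invr_gt0.
rewrite horner_coef mulr_suml mulr_suml.
apply: le_trans (ler_norm_sum _ _ _) _; apply: ler_sum => i _.
rewrite -!mulrA !normrM ler_wpM2l//.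
rewrite (gtr0_norm (expR_gt0 _)) (gtr0_norm t0).
rewrite (ger0_norm (exprn_ge0 _ (ltW s0))).
rewrite expRN ler_pdivrMr ?expR_gt0//.
have := @expR_ge1Dxn R t^-1 i (ltW s0).
move=> h; have {}h : t^-1 ^+ i.+1 / i.+1`!%:R <= expR t^-1.
  by move: h; set e := expR _; lra.
rewrite ler_pdivrMr in h; last by rewrite ltr0n fact_gt0.
move: h; rewrite exprS ler_pdivrMl// => /le_trans; apply.
lra.
Qed.

Lemma flat_cvg0 Q : {for 0, continuous (flat Q)}.
Proof.
have [K K0 hK] := flat_bound Q.
rewrite /prop_for/continuous_at {2}/flat lexx.
apply/cvgr0Pnorm_le => e e0.
have K1 : 0 < K + 1 by lra.
have Ke : 0 < (K + 1)^-1 * e by rewrite mulr_gt0// invr_gt0.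
near=> t.
apply: le_trans (hK t) _.
apply: (@le_trans _ _ ((K + 1) * `|t|)); first by rewrite ler_wpM2r//; lra.
by rewrite -ler_pdivlMl//; near: t; exact: nbhs0_le.
Unshelve. all: by end_near. Qed.

(** At the origin the difference quotient is [flat ('X * Q)], which tends to
    0 like any other member of the family. *)
Lemma is_derive_flat Q (x : R) :
  is_derive x (1 : R) (flat Q) (flat ('X^2 * (Q - Q^`())) x).
Proof.
have [x0|x0|->] := ltgtP x 0.
- have -> : flat ('X^2 * (Q - Q^`())) x = 0 by rewrite /flat ltW.
  apply: (@near_eq_is_derive _ _ _ (cst 0)).
    by near=> t; rewrite /flat ifT//; apply/ltW; near: t; exact: lt_nbhsl.
- have -> : flat ('X^2 * (Q - Q^`())) x =
      ('X^2 * (Q - Q^`())).[x^-1] * expR (- x^-1) by rewrite /flat leNgt x0.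
  apply: (@near_eq_is_derive _ _ _ (fun t : R => Q.[t^-1] * expR (- t^-1))).
    by near=> t; rewrite /flat leNgt ifF//; apply/negbF; near: t; exact: lt_nbhsr.
  have xn0 : x != 0 by rewrite gt_eqF.
  have dV : is_derive x (1 : R) (fun t : R => t^-1) (- x ^- 2).
    apply: (is_derive_eq (@is_deriveV R id x _ 1 xn0 (is_derive_id x 1))).
    by rewrite /GRing.scale/= mulr1.
  have d1 : is_derive x (1 : R) (fun t : R => Q.[t^-1])
      (Q^`().[x^-1] * (- x ^- 2)).
    exact: (@is_derive1_comp _ (horner Q) (fun t : R => t^-1)).
  have d2 : is_derive x (1 : R) (fun t : R => expR (- t^-1))
      (expR (- x^-1) * (x ^- 2)).
    apply: (@is_derive1_comp _ expR (fun t : R => - t^-1)).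
    by rewrite -[x ^- 2]opprK; exact: is_deriveN.
  apply: is_derive_eq; rewrite /GRing.scale/=.
  rewrite hornerM hornerXn hornerD hornerN -exprVn; ring.
- have -> : flat ('X^2 * (Q - Q^`())) 0 = 0 by rewrite /flat lexx.
  apply/is_derive1_caratheodory.
  exists (flat ('X * Q)); split; last by rewrite /flat lexx.
    move=> z; rewrite {2 3}/flat lexx !subr0 /flat; case: ifPn => z0.
      by rewrite mul0r.
    rewrite -ltNge in z0.
    by rewrite !hornerE; field; rewrite gt_eqF.
  exact: flat_cvg0.
Unshelve. all: by end_near. Qed.

Lemma smooth1_flat Q : smooth1 (flat Q).
Proof.
move=> n; elim: n Q => [|n IH] Q.
  by apply: derivable_continuous => x; case: (is_derive_flat Q x).
by apply: CkS; [exact: is_derive_flat|exact: IH].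
Qed.

End smooth_line.

(** * A smooth bump whose integer translates sum to one *)

Section profile.
Context {R : realType}.

Let e : R -> R := flat 1.

Let e_ge0 t : 0 <= e t.
Proof.
by rewrite /e /flat; case: ifP => // _; rewrite hornerC mul1r expR_ge0.
Qed.

Let e_gt0 t : 0 < t -> 0 < e t.
Proof. by move=> t0; rewrite /e /flat leNgt t0/= hornerC mul1r expR_gt0. Qed.

Let e_le0 t : t <= 0 -> e t = 0.
Proof. by move=> t0; rewrite /e /flat t0. Qed.

Let den (t : R) : R := e t + e ((-1) * t + 1).

Let den_neq0 t : den t != 0.
Proof.
rewrite gt_eqF// /den; have [t0|t0] := ltP 0 t.
  by rewrite ltr_wpDr// e_gt0.
by rewrite ltr_wpDl// e_gt0//; lra.
Qed.

Definition smooth_step (t : R) : R := e t * (den t)^-1.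

Lemma smooth1_step : smooth1 smooth_step.
Proof.
move=> n; apply: CkM; first exact: smooth1_flat.
apply: CkV; first exact: den_neq0.
by apply: CkD; [|apply: Ck_affine]; exact: smooth1_flat.
Qed.

Lemma smooth_step0 t : t <= 0 -> smooth_step t = 0.
Proof. by move=> t0; rewrite /smooth_step e_le0 ?mul0r. Qed.

Lemma smooth_step1 t : 1 <= t -> smooth_step t = 1.
Proof.
move=> t1; rewrite /smooth_step /den [e (_ + _)]e_le0; last by lra.
by rewrite addr0 mulfV// gt_eqF// e_gt0//; lra.
Qed.

(** Equal to 0 left of the origin and to t from t = 1 on: its derivative goes
    from 0 to 1, although it need not be monotone in between. *)
Definition smooth_ramp (t : R) : R := t * smooth_step t.

Lemma smooth1_ramp : smooth1 smooth_ramp.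
Proof. by move=> n; apply: CkM; [exact: Ck_id|exact: smooth1_step]. Qed.

Lemma derive_ramp0 t : t < 0 -> derive1 smooth_ramp t = 0.
Proof.
move=> t0; rewrite derive1E (@near_eq_derive _ _ _ _ (cst 0)) ?derive_cst//.
near=> x; rewrite /smooth_ramp smooth_step0 ?mulr0//.
by apply/ltW; near: x; exact: lt_nbhsl.
Unshelve. all: by end_near. Qed.

Lemma derive_ramp1 t : 1 < t -> derive1 smooth_ramp t = 1.
Proof.
move=> t0; rewrite derive1E (@near_eq_derive _ _ _ _ id) ?derive_id//.
near=> x; rewrite /smooth_ramp smooth_step1 ?mulr1//.
by apply/ltW; near: x; exact: lt_nbhsr.
Unshelve. all: by end_near. Qed.

(** A smooth passage from 0 to 1, taken as a difference of translates of one
    ramp so that the integer translates of its derivative telescope.  The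
    affine shape [1 * t + 1] is the one of [Ck_affine]. *)
Definition profile (t : R) : R :=
  smooth_ramp (1 * t + 1) + (-1) * smooth_ramp t.

Lemma smooth1_profile : smooth1 profile.
Proof.
move=> n; apply: CkD; first by apply: Ck_affine; exact: smooth1_ramp.
by apply: CkM; [exact: Ck_cst|exact: smooth1_ramp].
Qed.

Lemma profile0 t : t <= -1 -> profile t = 0.
Proof.
by move=> t1; rewrite /profile /smooth_ramp !smooth_step0 ?mulr0 ?addr0//; lra.
Qed.

Lemma profile1 t : 1 <= t -> profile t = 1.
Proof.
by move=> t1; rewrite /profile /smooth_ramp !smooth_step1 ?mulr1; lra.
Qed.

Definition unit_bump : R -> R := derive1 profile.

Lemma unit_bumpE t :
  unit_bump t = derive1 smooth_ramp (t + 1) - derive1 smooth_ramp t.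
Proof.
have d x := CkSP (smooth1_ramp 1) x.
rewrite /unit_bump derive1E -[in RHS](mul1r t).
have d1 : is_derive t (1 : R) (fun t => smooth_ramp (1 * t + 1))
    (derive1 smooth_ramp (1 * t + 1) * 1).
  apply: (@is_derive1_comp _ smooth_ramp (fun x : R => 1 * x + 1)).
  by apply: is_derive_eq; rewrite /GRing.scale/= mulr1 addr0.
have d2 : is_derive t (1 : R) (fun t => (-1) * smooth_ramp t)
    ((-1) * derive1 smooth_ramp t).
  by have dt := d t; exact: is_deriveZ.
have /@derive_val -> := is_deriveD d1 d2.
by rewrite !mulr1 mulN1r !mul1r.
Qed.

Lemma unit_bump_out t : 1 < `|t| -> unit_bump t = 0.
Proof.
move=> t1; rewrite unit_bumpE; have [t0|t0] := leP 0 t.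
  rewrite ger0_norm// in t1.
  by rewrite !derive_ramp1 ?subrr//; lra.
rewrite ltr0_norm// in t1.
by rewrite !derive_ramp0 ?subrr//; lra.
Qed.

(** Each term is the difference of the ramp's slope at two consecutive
    integer translates; the sum collapses to slope 1 minus slope 0. *)
Lemma sum_unit_bump n t : `|t| < n%:R ->
  \sum_(i < n.*2.+1) unit_bump (t - (i%:R - n%:R)) = 1.
Proof.
rewrite ltr_norml => /andP[t1 t2].
pose a i := derive1 smooth_ramp (t - (i%:R - n%:R) + 1).
transitivity (\sum_(0 <= i < n.*2.+1) - (a i.+1 - a i)).
  rewrite big_mkord; apply: eq_bigr => i _.
  rewrite [RHS]opprB unit_bumpE; congr (_ - derive1 _ _).
  by rewrite -[i.+1]addn1 natrD; lra.
rewrite sumrN telescope_sumr// /a.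
rewrite derive_ramp0; last by rewrite -addn1 -muln2 natrD natrM; lra.
by rewrite derive_ramp1; lra.
Qed.

Lemma continuous_bounded (f : R -> R) : continuous f ->
  exists2 C, 0 <= C & forall t, `|t| <= 1 -> `|f t| <= C.
Proof.
move=> cf.
have [|c _ hc] := @EVT_max R (fun t => `|f t|) (-1) 1 ltac:(lra).
  by apply: continuous_subspaceT => x; apply: (cvg_norm (cf x)).
exists `|f c| => // t; rewrite ler_norml => t1; apply: hc.
by rewrite in_itv.
Qed.

Lemma profile_bound :
  exists2 C, 1 <= C & forall t, `|profile t| <= C /\ `|unit_bump t| <= C.
Proof.
have [C C0 hC] := continuous_bounded (smooth1_continuous smooth1_profile).
have [D D0 hD] :=
  continuous_bounded (smooth1_continuous (smooth1_derive smooth1_profile)).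
exists (1 + C + D) => [|t]; first lra.
have [t1|t1] := leP `|t| 1; split.
- by apply: le_trans (hC _ t1) _; lra.
- by apply: le_trans (hD _ t1) _; lra.
- have [t0|t0] := leP 0 t.
    rewrite ger0_norm// in t1; rewrite profile1 ?normr1; lra.
  rewrite ltr0_norm// in t1; rewrite profile0 ?normr0; lra.
- by rewrite unit_bump_out// normr0; lra.
Qed.

Lemma measurable_unit_bump : measurable_fun [set: R] unit_bump.
Proof.
apply: continuous_measurable_fun; apply: smooth1_continuous.
exact: smooth1_derive smooth1_profile.
Qed.

End profile.

(** * Test functions of product form *)

Section tensor.
Context {R : realType} {n : nat}.
Implicit Types (g : 'I_n -> R -> R) (y : 'rV[R]_n) (i : 'I_n).

Definition tensor g y : R := \prod_i g i (y ord0 i).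

(** Differentiating a product along axis i changes the i-th factor only. *)
Definition replace g i (f : R -> R) : 'I_n -> R -> R :=
  fun j => if j == i then f else g j.

Lemma tensorD1 g i y :
  tensor g y = g i (y ord0 i) * \prod_(j | j != i) g j (y ord0 j).
Proof. by rewrite /tensor (bigD1 i). Qed.

Lemma tensor_replace g i f y :
  tensor (replace g i f) y = f (y ord0 i) * \prod_(j | j != i) g j (y ord0 j).
Proof.
rewrite (tensorD1 _ i) /replace eqxx; congr (_ * _).
by apply: eq_bigr => j /negPf ->.
Qed.

Lemma continuous_tensor g : (forall i, continuous (g i)) -> continuous (tensor g).
Proof.
move=> cg; rewrite /tensor.
elim: (index_enum _) => [|i s IH].
  by under eq_fun do rewrite big_nil; exact: cst_continuous.
under eq_fun do rewrite big_cons.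
move=> y.
have gy : {for y, continuous (g i \o (fun y : 'rV[R]_n => y ord0 i))}.
  by apply: continuous_comp; [exact: coord_continuous|exact: cg].
exact: (cvgM gy (IH y)).
Qed.

Lemma is_derive_tensor g i y : derivable (g i) (y ord0 i) (1 : R) ->
  is_derive y (delta_mx ord0 i : 'rV[R]_n) (tensor g)
    (tensor (replace g i (derive1 (g i))) y).
Proof.
move=> dg.
set P := \prod_(j | j != i) g j (y ord0 j).
have cg := @derivableP _ _ _ _ _ _ dg.
have h : (fun h : R => h^-1 *: ((tensor g \o shift y)
      (h *: (delta_mx ord0 i : 'rV[R]_n)) - tensor g y)) =
    (fun h : R => h^-1 *: ((g i \o shift (y ord0 i)) (h *: (1 : R))
      - g i (y ord0 i)) * P).
  apply/funext => h; rewrite /= !(tensorD1 _ i) !mxE !eqxx/= mulr1.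
  rewrite /GRing.scale/= mulr1 -mulrA; congr (_ * _).
  rewrite mulrBl; congr (_ * _ - _); apply: eq_bigr => j /negPf ji.
  by rewrite !mxE ji/= mulr0 add0r.
have cv : (fun h : R => h^-1 *: ((tensor g \o shift y)
      (h *: (delta_mx ord0 i : 'rV[R]_n)) - tensor g y)) @ 0^' -->
      (tensor (replace g i (derive1 (g i))) y : R).
  rewrite h tensor_replace; apply: cvgM; last exact: cvg_cst.
  by rewrite derive1E; exact: dg.
split; first by apply/cvg_ex; eexists; exact: cv.
exact: cvg_lim cv.
Qed.

Lemma pderiv_tensor g i : smooth1 (g i) ->
  pderiv i (tensor g) = tensor (replace g i (derive1 (g i))).
Proof.
move=> sg; apply/funext => y; rewrite /pderiv.
by have [_ ->] := @is_derive_tensor g i y (@smooth1_derivable _ _ _ sg).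
Qed.

Lemma smooth_replace g i f : (forall j, smooth1 (g j)) -> smooth1 f ->
  forall j, smooth1 (replace g i f j).
Proof. by move=> sg sf j; rewrite /replace; case: ifP. Qed.

(** Products of smooth factors are stable under every partial derivative,
    which reduces smoothness on R^n to smoothness on the line. *)
Lemma iter_pderiv_tensor g (s : seq 'I_n) : (forall j, smooth1 (g j)) ->
  exists2 g', (forall j, smooth1 (g' j)) & iter_pderiv s (tensor g) = tensor g'.
Proof.
move=> sg; elim: s => [|i s [g' sg' IH]]; first by exists g.
exists (replace g' i (derive1 (g' i))).
  by apply: smooth_replace => //; exact: smooth1_derive.
by rewrite /= IH pderiv_tensor.
Qed.

Lemma smooth_tensor g : (forall j, smooth1 (g j)) -> smooth (tensor g).
Proof.
move=> sg s; have [g' sg' ->] := iter_pderiv_tensor s sg; split.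
  by apply: continuous_tensor => i; exact: smooth1_continuous.
move=> i x.
by have [] := @is_derive_tensor g' i x (@smooth1_derivable _ _ _ (sg' i)).
Qed.

(** The closure of the support lies in a product of segments, which is
    compact. *)
Lemma test_function_tensor g (a b : 'I_n -> R) : (forall j, smooth1 (g j)) ->
  (forall j t, g j t != 0 -> a j <= t <= b j) -> test_function (tensor g).
Proof.
move=> sg supp; split; first exact: smooth_tensor.
have cB : compact [set y : 'rV[R]_n | forall i, `[a i, b i]%classic (y ord0 i)].
  apply: (@rV_compact R n (fun i => `[a i, b i]%classic)) => i.
  exact: segment_compact.
apply: (subclosed_compact _ cB); first exact: closed_closure.
have /closure_id -> :
    closed [set y : 'rV[R]_n | forall i, `[a i, b i]%classic (y ord0 i)].
  by apply: compact_closed => //; exact: norm_hausdorff.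
apply: closure_subset => y /= + i; rewrite (tensorD1 _ i) in_itv/=.
by rewrite mulf_eq0 negb_or => /andP[/supp].
Qed.

Lemma measurable_tensor g : (forall i, measurable_fun setT (g i)) ->
  measurable_fun [set: 'rV[R]_n] (tensor g).
Proof.
move=> mg; apply: measurable_prod => i _.
exact: (measurableT_comp (mg i) (measurable_coord i)).
Qed.

End tensor.

(** * Almost everywhere equal functions and Hoelder pairings *)

Section integral_ae.
Local Open Scope ereal_scope.
Context d (T : measurableType d) (R : realType).
Variable mu : {measure set T -> \bar R}.
Implicit Types f g : T -> \bar R.

(** The integral of a nonnegative function is a supremum over the simple
    functions below it, so monotonicity needs no measurability. *)
Lemma ge0_integral_mono f g : (forall x, 0 <= f x) -> (forall x, f x <= g x) ->
  \int[mu]_x f x <= \int[mu]_x g x.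
Proof.
move=> f0 fg; rewrite !ge0_integralTE//; last first.
  by move=> x; exact: le_trans (fg x).
apply: le_ereal_sup => _ [h /= hf <-]; exists h => // x.
exact: le_trans (hf x) _.
Qed.

(** f lies between two measurable modifications of g on a null set: one is
    +oo there, the other 0. *)
Lemma ge0_integral_ae_eq f g : (forall x, 0 <= f x) -> (forall x, 0 <= g x) ->
  measurable_fun [set: T] g -> {ae mu, forall x, f x = g x} ->
  \int[mu]_x f x = \int[mu]_x g x.
Proof.
move=> f0 g0 mg [A [mA A0 fgA]].
have fg x : ~ A x -> f x = g x by move=> nA; apply: contrapT => /fgA.
have mCA : measurable (~` A) by exact: measurableC.
apply/eqP; rewrite eq_le; apply/andP; split.
- pose g1 x := if x \in A then +oo else g x.
  have mg1 : measurable_fun [set: T] g1.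
    apply: measurable_fun_ifT => //; apply: (measurable_fun_bool true).
    rewrite setTI (_ : _ @^-1` _ = A)//; apply/seteqP.
    by split => x /=; [exact: set_mem|exact: mem_set].
  have g10 x : 0 <= g1 x by rewrite /g1; case: ifP.
  apply: le_trans (ge0_integral_mono f0 (g := g1) _) _.
    move=> x; rewrite /g1; case: ifPn => [_|]; first exact: leey.
    by rewrite notin_setE => /fg ->.
  rewrite (@ge0_ae_eq_integral _ _ _ mu setT g1 g)//.
  exists A; split => // x /= nx; apply: contrapT => nA; apply: nx => _.
  by rewrite /g1 memNset.
- pose g1 x := if x \in A then 0 else g x.
  have mg1 : measurable_fun [set: T] g1.
    apply: measurable_fun_ifT => //; apply: (measurable_fun_bool true).
    rewrite setTI (_ : _ @^-1` _ = A)//; apply/seteqP.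
    by split => x /=; [exact: set_mem|exact: mem_set].
  have g10 x : 0 <= g1 x by rewrite /g1; case: ifP.
  rewrite (@ge0_ae_eq_integral _ _ _ mu setT g g1)//; last first.
    exists A; split => // x /= nx; apply: contrapT => nA; apply: nx => _.
    by rewrite /g1 memNset.
  apply: ge0_integral_mono => // x; rewrite /g1; case: ifPn => //.
  by rewrite notin_setE => /fg ->.
Qed.

Lemma ae_eq_integral_measurable f g : measurable_fun [set: T] g ->
  {ae mu, forall x, f x = g x} -> \int[mu]_x f x = \int[mu]_x g x.
Proof.
move=> mg fg; rewrite integralE [RHS]integralE; congr (_ - _).
- apply: ge0_integral_ae_eq => //; first exact: measurable_funepos.
  by apply: filterS fg => x /= fgx; rewrite !funeposE fgx.
- apply: ge0_integral_ae_eq => //; first exact: measurable_funeneg.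
  by apply: filterS fg => x /= fgx; rewrite !funenegE fgx.
Qed.

Lemma Lnorm_ae_eq (p : R) f g : measurable_fun [set: T] g ->
  {ae mu, forall x, f x = g x} -> Lnorm mu p%:E f = Lnorm mu p%:E g.
Proof.
move=> mg fg; rewrite unlock; congr (_ `^ _).
apply: ae_eq_integral_measurable; last by apply: filterS fg => x /= ->.
apply: (measurableT_comp (measurable_poweR p)).
exact: measurableT_comp.
Qed.

(** Hoelder's inequality against the indicator of B, whose norm at the
    conjugate exponent is a power of the measure of B. *)
Lemma integral_abs_Lnorm_le (p a b : R) (g : T -> R) (B : set T) :
  (1 < p)%R -> measurable_fun [set: T] g -> measurable B ->
  Lnorm mu p%:E (EFin \o g) = a%:E -> mu B = b%:E ->
  \int[mu]_(x in B) `|(g x)%:E| <= (a * b `^ (1 - p^-1))%:E.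
Proof.
move=> p1 mg mB ga Bb.
have p0 : (0 < p)%R by lra.
have q0 : (0 < (1 - p^-1)^-1)%R by rewrite invr_gt0 subr_gt0 invf_lt1.
have := @hoelder _ _ _ mu g (\1_B) p (1 - p^-1)^-1 mg
  (measurable_indic mB) p0 q0 ltac:(rewrite invrK; lra).
rewrite ga EFinM.
have -> : Lnorm mu (1 - p^-1)^-1%:E (EFin \o \1_B) = (b `^ (1 - p^-1))%:E.
  rewrite unlock invrK -poweR_EFin -Bb; congr (_ `^ _).
  rewrite -[B in RHS]setIT -integral_indic//.
  apply: eq_integral => x _ /=.
  rewrite indicE; case: (x \in B) => /=; first by rewrite normr1 powR1.
  by rewrite normr0 powR0// gt_eqF.
apply: le_trans; rewrite Lnorm1 integral_mkcond.
rewrite le_eqVlt; apply/orP; left; apply/eqP; apply: eq_integral => x _.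
rewrite patchE /= indicE; case: (x \in B) => /=; first by rewrite mulr1.
by rewrite mulr0 normr0.
Qed.

(** The form in which the L^p norms enter the estimates: a kernel bounded by c
    and carried by B costs c mu(B)^(1 - 1/p). *)
Lemma pairing_bound (p a b c : R) (g phi : T -> R) (B : set T) :
  (1 < p)%R -> (0 <= c)%R -> measurable_fun [set: T] g -> measurable B ->
  Lnorm mu p%:E (EFin \o g) = a%:E -> mu B = b%:E ->
  measurable_fun [set: T] phi -> (forall x, B x -> `|phi x| <= c)%R ->
  (forall x, ~ B x -> phi x = 0%R) ->
  mu.-integrable setT (fun x => (g x * phi x)%:E) /\
  `|\int[mu]_x (g x * phi x)%:E| <= (c * (a * b `^ (1 - p^-1)))%:E.
Proof.
move=> p1 c0 mg mB ga Bb mphi phiB phi0.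
have h := integral_abs_Lnorm_le p1 mg mB ga Bb.
have mgphi : measurable_fun [set: T] (fun x => (g x * phi x)%:E).
  by apply/measurable_EFinP; exact: measurable_funM.
have {}h : \int[mu]_x `|(g x * phi x)%:E| <= (c * (a * b `^ (1 - p^-1)))%:E.
  rewrite EFinM.
  apply: (@le_trans _ _ (c%:E * \int[mu]_(x in B) `|(g x)%:E|)); last first.
    by apply: lee_wpmul2l => //; rewrite lee_fin.
  have mag : measurable_fun B (fun x => `|(g x)%:E|).
    apply: measurableT_comp => //; apply/measurable_EFinP.
    exact: measurable_funTS.
  rewrite -ge0_integralZl//.
  rewrite [leRHS]integral_mkcond; apply: ge0_le_integral => //.
  - exact: measurableT_comp.
  - by apply/(measurable_restrictT _ mB); exact: measurable_funeM.
  - move=> x _; rewrite patchE; case: ifPn; rewrite ?inE ?notin_setE => Bx.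
      by rewrite -EFinM lee_fin normrM mulrC ler_wpM2r// phiB.
    by rewrite phi0// mulr0 abse0.
split; last by apply: le_trans (le_abse_integral _ _ _) h.
by apply/integrableP; split => //; apply: le_lt_trans h _; rewrite ltry.
Qed.

End integral_ae.

(** * Inner regularity by closed sets *)

Section closed_regularity.
Local Open Scope ereal_scope.
Context (R : realType) (n : nat).
Variables (mu : {measure set 'rV[R]_n -> \bar R}) (D : set 'rV[R]_n).
Hypotheses (mD : measurable D) (Dfin : mu D < +oo).
Implicit Types A K : set 'rV[R]_n.

(** Approximation from inside by closed sets, up to arbitrarily small mass in
    the window D, where mu is finite. *)
Definition inner_closed A := forall eps : R, (0 < eps)%R ->
  exists K, [/\ closed K, measurable K, K `<=` A & mu ((A `\` K) `&` D) <= eps%:E].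

Lemma inner_closed_closed A : closed A -> measurable A -> inner_closed A.
Proof.
move=> cA mA eps e0; exists A; split => //.
by rewrite setDv set0I measure0 lee_fin ltW.
Qed.

Let half_sum (eps : R) : (0 < eps)%R ->
  \sum_(0 <= i <oo) (eps / (2 ^ i.+1)%:R)%:E <= eps%:E.
Proof.
move=> e0; have := @epsilon_trick R (fun=> 0) eps xpredT (fun=> lexx _) (ltW e0).
have -> : \sum_(0 <= i <oo) (0 : \bar R) = 0 by exact: eseries0.
rewrite add0e; apply: le_trans.
by under [leRHS]eq_eseriesr do rewrite add0e.
Qed.

(** A countable union of closed sets need not be closed; continuity from
    above, available because D has finite mass, allows a finite union. *)
Lemma inner_closed_bigcup (A : nat -> set 'rV[R]_n) :
  (forall i, measurable (A i)) -> (forall i, inner_closed (A i)) ->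
  inner_closed (\bigcup_i A i).
Proof.
move=> mA iA eps e0.
(* Half of eps for the closed approximations, so that passing to a finite
   union can be paid for by a strict inequality. *)
have e2 : (0 < eps / 2)%R by rewrite divr_gt0.
have /choice[K hK] : forall i, exists K, [/\ closed K, measurable K, K `<=` A i &
    mu ((A i `\` K) `&` D) <= (eps / 2 / (2 ^ i.+1)%:R)%:E].
  by move=> i; apply: iA; rewrite divr_gt0// ltr0n expn_gt0.
have mK i : measurable (K i) by case: (hK i).
have mUA : measurable (\bigcup_i A i) by exact: bigcupT_measurable.
have mUK : measurable (\bigcup_i K i) by exact: bigcupT_measurable.
pose L m := \big[setU/set0]_(i < m) K i.
have mL m : measurable (L m) by exact: bigsetU_measurable.
pose F m := (\bigcup_i A i `\` L m) `&` D.
have mF m : measurable (F m) by apply: measurableI => //; exact: measurableD.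
have FE : \bigcap_m F m = (\bigcup_i A i `\` \bigcup_i K i) `&` D.
  rewrite /F; apply/seteqP; split => x.
    move=> h; have [[Ax _] Dx] := h 0%N I; split => //; split => // -[i _ Kx].
    have [[_ nL] _] := h i.+1 I; apply: nL.
    by rewrite /L -bigcup_mkord; exists i => //=.
  move=> [[Ax nK] Dx] m _; split => //; split => // Lx; apply: nK.
  by move: Lx; rewrite /L -bigcup_mkord => -[i _ Kx]; exists i.
have cF : mu \o F @ \oo --> mu (\bigcap_m F m).
  apply: nonincreasing_cvg_mu => //.
  - apply: le_lt_trans Dfin; apply: le_measure; rewrite ?inE//.
    by move=> x [].
  - by rewrite FE; apply: measurableI => //; exact: measurableD.
  - move=> m k mk; apply/subsetPset => x [[Ax nL] Dx]; split => //; split => // Lx.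
    by apply: nL; move: x {Ax Dx} Lx; exact: subset_bigsetU.
have small : mu (\bigcap_m F m) < eps%:E.
  apply: (@le_lt_trans _ _ (eps / 2)%:E); last by rewrite lte_fin; lra.
  apply: le_trans (half_sum e2).
  apply: (@le_trans _ _ (\sum_(0 <= i <oo) mu ((A i `\` K i) `&` D))).
    apply: measure_sigma_subadditive.
    - by move=> i; apply: measurableI => //; exact: measurableD.
    - by rewrite FE; apply: measurableI => //; exact: measurableD.
    - rewrite FE => x [[[i _ Ax] nK] Dx]; exists i => //; split => //; split => //.
      by move=> Kx; apply: nK; exists i.
  by apply: lee_nneseries => // i _; case: (hK i).
have [m _ hm] : \forall m \near \oo, mu (F m) < eps%:E.
  exact: (cF [set y | y < eps%:E] (open_ereal_lt' small)).
exists (L m); split => //.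
- by apply: closed_bigsetU => i _; case: (hK i).
- rewrite /L -bigcup_mkord => x [i _ Kx]; exists i => //.
  by case: (hK i) => _ _ + _; exact.
- by apply/ltW; apply: hm => /=.
Qed.

Lemma inner_closed_bigcap (A : nat -> set 'rV[R]_n) :
  (forall i, measurable (A i)) -> (forall i, inner_closed (A i)) ->
  inner_closed (\bigcap_i A i).
Proof.
move=> mA iA eps e0.
have /choice[K hK] : forall i, exists K, [/\ closed K, measurable K, K `<=` A i &
    mu ((A i `\` K) `&` D) <= (eps / (2 ^ i.+1)%:R)%:E].
  by move=> i; apply: iA; rewrite divr_gt0// ltr0n expn_gt0.
have mK i : measurable (K i) by case: (hK i).
have mIA : measurable (\bigcap_i A i) by exact: bigcapT_measurable.
have mIK : measurable (\bigcap_i K i) by exact: bigcapT_measurable.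
exists (\bigcap_i K i); split => //.
- by apply: closed_bigI => i _; case: (hK i).
- by move=> x Kx i _; case: (hK i) => _ _ + _; apply; exact: Kx.
- apply: le_trans (half_sum e0).
  apply: (@le_trans _ _ (\sum_(0 <= i <oo) mu ((A i `\` K i) `&` D))).
    apply: measure_sigma_subadditive.
    + by move=> i; apply: measurableI => //; exact: measurableD.
    + by apply: measurableI => //; exact: measurableD.
    + move=> x [[Ax nK] Dx]; apply: contrapT => h; apply: nK => i _.
      apply: contrapT => nKx; apply: h; exists i => //; split => //; split => //.
      exact: Ax.
  by apply: lee_nneseries => // i _; case: (hK i).
Qed.

(** Asking for the property on the complement as well makes the class stable
    under complements by definition. *)
Definition bi_inner A := [/\ measurable A, inner_closed A & inner_closed (~` A)].

Lemma sigma_algebra_bi_inner : sigma_algebra setT bi_inner.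
Proof.
split.
- split => //; first by apply: inner_closed_closed => //; exact: closed0.
  by rewrite setC0; apply: inner_closed_closed => //; exact: closedT.
- by move=> A [mA iA iCA]; rewrite setTD; split;
    [exact: measurableC|by []|rewrite setCK].
- move=> A hA; have mA i : measurable (A i) by case: (hA i).
  split; first exact: bigcupT_measurable.
    by apply: inner_closed_bigcup => // i; case: (hA i).
  rewrite setC_bigcup; apply: inner_closed_bigcap => i; last by case: (hA i).
  exact: measurableC.
Qed.

Let coord (i : 'I_n) (y : 'rV[R]_n) : R := y ord0 i.

(** An open half-space is an increasing union of closed half-spaces, and its
    complement is closed. *)
Lemma bi_inner_ray (i : 'I_n) (x : R) : bi_inner (coord i @^-1` `]x, +oo[%classic).
Proof.
have mp (B : set R) : measurable B -> measurable (coord i @^-1` B).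
  by move=> mB; rewrite -[X in measurable X]setTI; exact: measurable_coord.
have cp (B : set R) : closed B -> closed (coord i @^-1` B).
  by apply: closed_comp => y _; exact: coord_continuous.
split; first by apply: mp; exact: measurable_itv.
- have -> : coord i @^-1` `]x, +oo[%classic =
      \bigcup_k coord i @^-1` `[(x + k.+1%:R^-1)%R, +oo[%classic.
    by rewrite -preimage_bigcup -itvoyEbigcup.
  apply: inner_closed_bigcup => k; first by apply: mp; exact: measurable_itv.
  apply: inner_closed_closed; last by apply: mp; exact: measurable_itv.
  by apply: cp; exact: interval_closed.
- rewrite preimage_setC setCitvr.
  apply: inner_closed_closed; last by apply: mp; exact: measurable_itv.
  by apply: cp; exact: interval_closed.
Qed.

Lemma measurable_bi_inner A : measurable A -> bi_inner A.
Proof.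
apply: smallest_sub; first exact: sigma_algebra_bi_inner.
rewrite -bigcup_seq => _ [i _] [B mB <-]; rewrite setTI.
have {mB} : (@ocitv R).-sigma.-measurable B := mB.
rewrite RGenOInfty.measurableE; move: B; apply: smallest_sub => /=.
  have [h0 hC hU] := sigma_algebra_bi_inner; split => /=.
  - by rewrite preimage_set0.
  - by move=> B /hC; rewrite !setTD preimage_setC.
  - by move=> B /hU; rewrite preimage_bigcup.
by move=> _ [x ->]; exact: bi_inner_ray.
Qed.

(** A closed set missing less than half of the mass of A has positive
    measure. *)
Lemma closed_subset_gt0 A : measurable A -> A `<=` D -> 0 < mu A ->
  exists K, [/\ closed K, measurable K, K `<=` A & 0 < mu K].
Proof.
move=> mA AD A0.
have Afin : mu A < +oo by apply: le_lt_trans Dfin; apply: le_measure; rewrite ?inE.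
have [_ iA _] := measurable_bi_inner mA.
have Aeq : mu A = (fine (mu A))%:E by rewrite fineK// ge0_fin_numE.
have a0 : (0 < fine (mu A))%R by rewrite -lte_fin -Aeq.
have [K [cK mK KA h]] := iA (fine (mu A) / 2)%R ltac:(rewrite divr_gt0//).
exists K; split => //; rewrite lt0e measure_ge0 andbT; apply/eqP => K0.
have : mu A <= (fine (mu A) / 2)%:E.
  apply: le_trans h; rewrite (_ : (A `\` K) `&` D = A `\` K); last first.
    by apply/setIidl => x [/AD].
  have -> : mu A = mu K + mu (A `\` K).
    rewrite -measureU//; [by rewrite setDUK|exact: measurableD|].
    by rewrite setDIK.
  by rewrite K0 add0e.
by rewrite {1}Aeq lee_fin; lra.
Qed.

End closed_regularity.

(** * Partitions of unity on a grid *)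

Section unit_cell.
Context {R : realType}.

Definition unit_cell (t : R) : R := ((0 <= t) && (t < 1))%:R.

Lemma unit_cell_ge0 t : 0 <= unit_cell t.
Proof. exact: ler0n. Qed.

Lemma unit_cell_out t : 1 < `|t| -> unit_cell t = 0.
Proof.
move=> t1; rewrite /unit_cell; case: andP => // -[t0 t2].
by move: t1; rewrite ger0_norm// ltNge (ltW t2).
Qed.

Lemma sum_unit_cellE m (t : R) :
  \sum_(i < m) unit_cell (t - i%:R) = (0 <= t)%R%:R - (m%:R <= t)%R%:R.
Proof.
elim: m => [|m IH]; first by rewrite big_ord0 mulr0n subrr.
rewrite big_ord_recr/= IH /unit_cell.
have -> : (t - m%:R < 1) = (t < m.+1%:R) by rewrite ltrBlDr -natr1 addrC.
rewrite subr_ge0 ltNge.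
have : (m.+1%:R <= t) -> (m%:R <= t) by apply: le_trans; rewrite ler_nat.
by case: (m.+1%:R <= t); case: (m%:R <= t) => //= h; try (by have := h isT); lra.
Qed.

Lemma sum_unit_cell_le1 m (t : R) : \sum_(i < m) unit_cell (t - i%:R) <= 1.
Proof.
rewrite sum_unit_cellE; apply: (@le_trans _ _ (0 <= t)%R%:R); last first.
  by case: (0 <= t)%R; rewrite ?ler01.
by rewrite lerBlDr lerDl.
Qed.

Lemma sum_unit_cell n (t : R) : `|t| < n%:R ->
  \sum_(i < n.*2.+1) unit_cell (t - (i%:R - n%:R)) = 1.
Proof.
rewrite ltr_norml => /andP[t1 t2].
under eq_bigr do rewrite opprB addrCA addrA [n%:R + t]addrC.
rewrite sum_unit_cellE.
have -> : 0 <= t + n%:R by lra.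
have -> : (n.*2.+1%:R <= t + n%:R) = false.
  by apply/negbTE; rewrite -ltNge -addn1 -muln2 natrD natrM; lra.
by rewrite subr0.
Qed.

(** At most three integer translates of a function supported in [-1, 1] are
    nonzero at a given point: |f| is dominated by C times three unit cells, and
    the translates of one unit cell are disjoint. *)
Lemma sum_local_le m (f : R -> R) C (t : R) : 0 <= C ->
  (forall t, 1 < `|t| -> f t = 0) -> (forall t, `|f t| <= C) ->
  \sum_(i < m) `|f (t - i%:R)| <= 3 * C.
Proof.
move=> C0 f0 fC.
have h s : `|f s| <= C * (unit_cell (s + 1) + unit_cell s + unit_cell (s - 1)).
  have [s1|s1] := ltP 1 `|s|.
    rewrite f0// normr0 mulr_ge0// !addr_ge0//; exact: unit_cell_ge0.
  apply: le_trans (fC s) _; rewrite ler_peMr//.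
  move: s1; rewrite ler_norml => /andP[s1 s2].
  have c1 (x : R) : 0 <= x -> x < 1 -> unit_cell x = 1.
    by move=> x0 x1; rewrite /unit_cell x0 x1.
  have := unit_cell_ge0 (s + 1); have := unit_cell_ge0 s.
  have := unit_cell_ge0 (s - 1).
  have [sn|sn] := ltP s 0; first by rewrite (c1 (s + 1)); lra.
  have [sp|sp] := ltP s 1; first by rewrite (c1 s); lra.
  by rewrite (c1 (s - 1)); lra.
apply: (@le_trans _ _ (\sum_(i < m) C * (unit_cell ((t + 1) - i%:R) +
    unit_cell (t - i%:R) + unit_cell ((t - 1) - i%:R)))).
  apply: ler_sum => i _; rewrite [t + 1 - _]addrAC [t - 1 - _]addrAC.
  exact: h.
rewrite -mulr_sumr [3 * C]mulrC ler_wpM2l// !big_split/=.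
have := sum_unit_cell_le1 m (t + 1); have := sum_unit_cell_le1 m t.
by have := sum_unit_cell_le1 m (t - 1); lra.
Qed.

End unit_cell.

Section partition_of_unity.
Context {R : realType} {n : nat}.
Variables (beta : R -> R) (C : R).
Hypotheses (C0 : 0 <= C) (beta_out : forall t, 1 < `|t| -> beta t = 0)
  (beta_le : forall t, `|beta t| <= C)
  (beta_sum : forall m t, `|t| < m%:R ->
    \sum_(i < m.*2.+1) beta (t - (i%:R - m%:R)) = 1)
  (measurable_beta : measurable_fun [set: R] beta).
Implicit Types (e : 'I_n -> R) (K : set 'rV[R]_n) (y : 'rV[R]_n).

(** Shifting the indices 0, ..., 2m by m gives the integers -m, ..., m. *)
Definition node m (f : {ffun 'I_n -> 'I_(m.*2.+1)}) (i : 'I_n) : R :=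
  (f i)%:R - m%:R.

Definition touches K e m (f : {ffun 'I_n -> 'I_(m.*2.+1)}) : bool :=
  `[< exists2 z, K z & forall i, `|z ord0 i / e i - node f i| <= 1 >].

Definition grid_fun e (s : 'I_n -> R) : 'rV[R]_n -> R :=
  tensor (fun i t => beta (t / e i - s i)).

(** The partition of unity with steps e, restricted to the members whose
    support touches K: once the grid is wide enough to cover K, it is 1 on K
    and vanishes beyond two steps from K. *)
Definition smear K e m y : R := \sum_(f | @touches K e m f) grid_fun e (node f) y.

Lemma grid_fun_neq0 e s y : grid_fun e s y != 0 ->
  forall i, `|y ord0 i / e i - s i| <= 1.
Proof.
move=> h i; rewrite leNgt; apply/negP => /beta_out b0; move/eqP: h; apply.
by rewrite /grid_fun (tensorD1 _ i) b0 mul0r.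
Qed.

(** On K the restriction to members touching K drops only vanishing terms, and
    the full sum factors into one-dimensional partitions of unity. *)
Lemma smear_eq1 K e m y : (forall i, `|y ord0 i / e i| < m%:R) -> K y ->
  smear K e m y = 1.
Proof.
move=> ym Ky; transitivity (\sum_f grid_fun e (@node m f) y : R).
  rewrite /smear big_mkcond; apply: eq_bigr => f _; case: ifPn => // /asboolPn h.
  apply/eqP; rewrite eq_sym; apply: contra_notT h => /grid_fun_neq0 h.
  by exists y.
pose G (i : 'I_n) (j : 'I_(m.*2.+1)) := beta (y ord0 i / e i - (j%:R - m%:R)).
transitivity (\prod_i \sum_j G i j); first by rewrite bigA_distr_bigA.
by apply: big1 => i _; exact: beta_sum.
Qed.

Lemma smear_le K e m y : `|smear K e m y| <= (3 * C) ^+ n.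
Proof.
apply: le_trans (ler_norm_sum _ _ _) _.
apply: (@le_trans _ _ (\sum_f `|@grid_fun e (@node m f) y|)).
  by rewrite [leRHS](bigID (@touches K e m))/= lerDl; apply: sumr_ge0.
pose G (i : 'I_n) (j : 'I_(m.*2.+1)) := `|beta (y ord0 i / e i - (j%:R - m%:R))|.
rewrite (_ : \sum_f _ = \prod_i \sum_j G i j); last first.
  rewrite bigA_distr_bigA; apply: eq_bigr => f _.
  by rewrite /grid_fun /tensor normr_prod.
rewrite -[X in _ ^+ X]card_ord -prodr_const; apply: ler_prod => i _.
apply/andP; split; first by apply: sumr_ge0 => j _; exact: normr_ge0.
rewrite /G; under eq_bigr do rewrite opprB addrCA addrA [m%:R + _]addrC.
exact: sum_local_le.
Qed.

Lemma smear_neq0 K e m y : (forall i, 0 < e i) -> smear K e m y != 0 ->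
  exists2 z, K z & forall i, `|y ord0 i - z ord0 i| <= 2 * e i.
Proof.
move=> e0 h; apply: contrapT => nh; move/eqP: h; apply.
apply: big1 => f /asboolP[z Kz zf]; apply: contrapT => /eqP/grid_fun_neq0 yf.
apply: nh; exists z => // i; rewrite -ler_pdivrMr//.
rewrite -[e i in leLHS]gtr0_norm// -normf_div mulrBl.
have := yf i; have := zf i; rewrite !ler_norml => /andP[? ?] /andP[? ?].
by apply/andP; split; lra.
Qed.

Lemma measurable_grid_fun e s : measurable_fun setT (grid_fun e s).
Proof.
apply: measurable_tensor => i; apply: measurableT_comp => //.
apply: measurable_funB; last exact: measurable_cst.
by apply: measurable_funM; [exact: measurable_id|exact: measurable_cst].
Qed.

Lemma measurable_smear K e m : measurable_fun setT (smear K e m).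
Proof.
have -> : smear K e m = (fun y => \sum_(f : {ffun 'I_n -> 'I_(m.*2.+1)})
    (if touches K e f then grid_fun e (node f) y else 0)).
  by apply/funext => y; rewrite /smear big_mkcond.
apply: measurable_sum => f; case: (touches K e f); last exact: measurable_cst.
exact: measurable_grid_fun.
Qed.

(** Off the closed set K, a ball around y misses K, while a member of the
    partition that touches K and does not vanish at y would put a point of K
    within twice the step of y. *)
Lemma smear_cvg K (e : nat -> 'I_n -> R) (m : nat -> nat) (b : R) y :
  closed K -> (forall z, K z -> forall i, `|z ord0 i| <= b) ->
  (forall k i, 0 < e k i) -> (forall i, e ^~ i @ \oo --> (0 : R)) ->
  (forall k i, b / e k i < (m k)%:R) ->
  (fun k => smear K (e k) (m k) y) @ \oo --> (\1_K y : R).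
Proof.
move=> cK Kb e0 ecv bm; apply: cvg_near_cst; rewrite indicE.
have [Ky|nKy] := pselect (K y).
  rewrite mem_set//; apply: nearW => k; apply: smear_eq1 => // i.
  rewrite normf_div (gtr0_norm (e0 k i)); apply: le_lt_trans (bm k i).
  by rewrite ler_pM2r ?invr_gt0//; exact: Kb.
rewrite memNset//.
have /nbhs_ballP[d /= d0 yd] : nbhs y (~` K).
  by apply: open_nbhs_nbhs; split => //; exact: closed_openC.
have d2 : 0 < d / 2 by rewrite divr_gt0.
have : \forall k \near \oo, forall i, e k i < d / 2.
  by apply: filter_forall => i; exact: (cvgr_lt _ (ecv i) _ d2).
apply: filterS => k ek; apply: contrapT => /eqP /smear_neq0 [//|z Kz yz].
apply: (yd z) => //; split => // i' i; rewrite ord1 /ball/=.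
by apply: le_lt_trans (yz i) _; have := ek i; lra.
Qed.

End partition_of_unity.

(** * Small-scale averages control the function *)

Section boxes.
Context {R : realType} {n : nat}.
Local Notation mu := (lebesgue_rV R n).
Implicit Types (c w e s : 'I_n -> R).

Definition cbox c w : set 'rV[R]_n :=
  [set y | forall i, `[c i - w i, c i + w i]%classic (y ord0 i)].

Definition box (a : R) := cbox (fun=> 0) (fun=> a).

Lemma cboxP c w y : cbox c w y <-> forall i, `|y ord0 i - c i| <= w i.
Proof.
by split => h i; have := h i; rewrite /= in_itv/= ler_distl.
Qed.

Lemma boxP a y : box a y <-> forall i, `|y ord0 i| <= a.
Proof.
split=> [/cboxP h i|h]; first by have := h i; rewrite subr0.
by apply/cboxP => i; rewrite subr0.
Qed.

Lemma measurable_cbox c w : measurable (cbox c w).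
Proof.
by apply: (@measurable_box R n (fun i => `[c i - w i, c i + w i]%classic)) => i;
  exact: measurable_itv.
Qed.

Lemma lebesgue_cbox c w : (forall i, 0 <= w i) ->
  mu (cbox c w) = (\prod_i (2 * w i))%:E.
Proof.
move=> w0.
rewrite (@lebesgue_rV_box R n (fun i => `[c i - w i, c i + w i]%classic));
  last by move=> i; exact: measurable_itv.
rewrite -prodEFin; apply: eq_bigr => i _.
rewrite lebesgue_measure_itv/= lte_fin -EFinD.
case: ifPn => [_|]; first by congr EFin; lra.
by rewrite -leNgt => h; congr EFin; have := w0 i; lra.
Qed.

Lemma lebesgue_box_lty a : (mu (box a) < +oo)%E.
Proof.
apply: (@le_lt_trans _ _ (mu (box `|a|))).
  apply: le_measure; rewrite ?inE; [exact: measurable_cbox..|].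
  by move=> y /boxP h; apply/boxP => i; apply: le_trans (h i) (ler_norm _).
by rewrite /box lebesgue_cbox ?ltry.
Qed.

Lemma integral_grid_cell e s : (forall i, 0 < e i) ->
  (\int[mu]_y (grid_fun unit_cell e s y)%:E = (\prod_i e i)%:E)%E.
Proof.
move=> e0.
pose A (i : 'I_n) : set R := `[e i * s i, e i * s i + e i[%classic.
have mA i : measurable (A i) by exact: measurable_itv.
pose B := [set y : 'rV[R]_n | forall i, A i (y ord0 i)].
have -> : (fun y => (grid_fun unit_cell e s y)%:E) = EFin \o \1_B.
  apply/funext => y /=; congr EFin; rewrite indicE.
  have cellE i : unit_cell (y ord0 i / e i - s i) = (y ord0 i \in A i)%:R.
    rewrite /unit_cell; congr (_%:R); rewrite mem_setE in_itv/=.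
    rewrite subr_ge0 ler_pdivlMr// ltrBlDr ltr_pdivrMr//.
    by rewrite mulrDl mul1r [s i * _]mulrC [e i + _]addrC.
  have [By|nBy] := pselect (B y).
    rewrite mem_set// /grid_fun /tensor big1// => i _.
    by rewrite cellE mem_set//; exact: By.
  rewrite memNset//; move: nBy => /existsNP[i nAi].
  by rewrite /grid_fun (tensorD1 _ i) cellE memNset// mul0r.
rewrite integral_indic//; last exact: measurable_box.
rewrite setIT; apply: (eq_trans (lebesgue_rV_box mA)).
rewrite -prodEFin; apply: eq_bigr => i _.
rewrite lebesgue_measure_itv/= lte_fin ltrDl e0 -EFinD.
by congr EFin; lra.
Qed.

End boxes.

Section closed_average.
Context {R : realType} {n : nat}.
Local Notation mu := (lebesgue_rV R n).
Variables (e : nat -> 'I_n -> R) (M : R).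
Hypotheses (e_gt0 : forall k i, 0 < e k i) (e_le1 : forall k i, e k i <= 1)
  (e_cvg : forall i, e ^~ i @ \oo --> (0 : R)) (M_gt0 : 0 < M).

(** The centres of the bumps are arbitrary; s measures them in units of the
    steps e k. *)
Definition bump_averages_le (F : 'rV[R]_n -> R) := forall k (s : 'I_n -> R),
  (`|\int[mu]_y (F y * grid_fun unit_bump (e k) s y)%:E| <=
    (M * \prod_i e k i)%:E)%E.

Definition box_integrable (F : 'rV[R]_n -> R) :=
  forall a : R, mu.-integrable (box a) (EFin \o F).

Lemma integrable_mul_bounded (F phi : 'rV[R]_n -> R) a c :
  measurable_fun setT F -> box_integrable F -> measurable_fun setT phi ->
  (forall y, `|phi y| <= c) -> (forall y, phi y != 0 -> box a y) ->
  mu.-integrable setT (fun y => (F y * phi y)%:E).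
Proof.
move=> mF iF mphi phic phia.
have -> : (fun y => (F y * phi y)%:E) = (fun y => (F y * phi y)%:E) \_ (box a).
  apply/funext => y; rewrite patchE; case: ifPn => //; rewrite notin_setE => nb.
  by have [->|/phia/nb//] := eqVneq (phi y) 0; rewrite mulr0.
apply/(integrable_mkcond _ (measurable_cbox _ _)).
apply: (@le_integrable _ _ _ mu _ _ _ (fun y => c%:E * (F y)%:E)%E).
- exact: measurable_cbox.
- by apply/measurable_EFinP; apply: measurable_funTS; exact: measurable_funM.
- move=> y _ /=; rewrite lee_fin !normrM mulrC ler_wpM2r//.
  exact: le_trans (phic y) (ler_norm _).
- by apply: integrableZl; [exact: measurable_cbox|exact: iF].
Qed.

Lemma exists_grid_size (b : R) : exists m : nat -> nat,
  forall k i, b / e k i < (m k)%:R.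
Proof.
exists (fun k => \max_i Num.bound `|b / e k i|) => k i.
apply: lt_le_trans (_ : (Num.bound `|b / e k i|)%:R <= _).
  exact: le_lt_trans (ler_norm _) (archi_boundP (normr_ge0 _)).
by rewrite ler_nat (@leq_bigmax _ (fun i => Num.bound `|b / e k i|)).
Qed.

Lemma grid_fun_box beta k (s : 'I_n -> R) (y : 'rV[R]_n) :
  (forall t, 1 < `|t| -> beta t = 0) -> grid_fun beta (e k) s y != 0 ->
  box (\sum_i (1 + `|s i|)) y.
Proof.
move=> bo /(grid_fun_neq0 bo) h; apply/boxP => i.
apply: (@le_trans _ _ (1 + `|s i|)).
  rewrite -[y ord0 i](divfK (lt0r_neq0 (e_gt0 k i))) normrM.
  rewrite (gtr0_norm (e_gt0 k i)).
  apply: (@le_trans _ _ `|y ord0 i / e k i|); first by rewrite ler_piMr.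
  rewrite -[y ord0 i / e k i](subrK (s i)); apply: le_trans (ler_normD _ _) _.
  by rewrite lerD2r.
by rewrite (bigD1 i)//= lerDl; apply: sumr_ge0 => j _; rewrite addr_ge0.
Qed.

Lemma box_integrable_cst1 : box_integrable (fun=> 1).
Proof.
move=> a; apply/integrableP; split; first exact: measurable_cst.
under eq_integral do rewrite /= normr1.
rewrite integral_cst; last exact: measurable_cbox.
by rewrite mul1e; exact: lebesgue_box_lty.
Qed.

Section smear_integral.
Variables (beta : R -> R) (C : R).
Hypotheses (C0 : 0 <= C) (beta_out : forall t, 1 < `|t| -> beta t = 0)
  (beta_le : forall t, `|beta t| <= C)
  (beta_sum : forall m t, `|t| < m%:R ->
    \sum_(i < m.*2.+1) beta (t - (i%:R - m%:R)) = 1)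
  (measurable_beta : measurable_fun [set: R] beta).
Variables (F : 'rV[R]_n -> R) (K : set 'rV[R]_n) (b : R).
Hypotheses (mF : measurable_fun setT F) (iF : box_integrable F)
  (cK : closed K) (mK : measurable K) (Kb : K `<=` box b).

Lemma integrable_grid_fun k s :
  mu.-integrable setT (fun y => (F y * grid_fun beta (e k) s y)%:E).
Proof.
apply: (@integrable_mul_bounded _ _ (\sum_i (1 + `|s i|)) (C ^+ n)) => //.
- exact: measurable_grid_fun.
- move=> y; rewrite /grid_fun /tensor normr_prod.
  rewrite -[X in _ ^+ X]card_ord -prodr_const; apply: ler_prod => i _.
  by rewrite normr_ge0 beta_le.
- by move=> y; exact: grid_fun_box.
Qed.

Lemma integral_smear k m :
  (\int[mu]_y (F y * smear beta K (e k) m y)%:E =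
   \sum_(f | @touches _ _ K (e k) m f)
     \int[mu]_y (F y * grid_fun beta (e k) (node f) y)%:E)%E.
Proof.
rewrite -(integral_sum _ _ (index_enum _)
  (fun f => @touches _ _ K (e k) m f))//; last first.
  by move=> f; exact: integrable_grid_fun.
by apply: eq_integral => y _; rewrite sumEFin -mulr_sumr.
Qed.

Lemma smear_box k m y : smear beta K (e k) m y != 0 -> box (b + 2) y.
Proof.
move=> /(smear_neq0 beta_out (e_gt0 k)) [z Kz yz]; apply/boxP => i.
have /boxP/(_ i) := Kb Kz; have := yz i; have := e_le1 k i.
by have := ler_normD (y ord0 i - z ord0 i) (z ord0 i); rewrite subrK; lra.
Qed.

Lemma cvg_integral_smear (m : nat -> nat) :
  (forall k i, b / e k i < (m k)%:R) ->
  ((\int[mu]_y (F y * smear beta K (e k) (m k) y)%:E) @[k --> \oo] -->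
   \int[mu]_(y in K) (F y)%:E)%E.
Proof.
move=> hm.
have -> : (\int[mu]_(y in K) (F y)%:E = \int[mu]_y (F y * \1_K y)%:E)%E.
  rewrite integral_mkcond; apply: eq_integral => y _.
  by rewrite patchE indicE; case: (y \in K); rewrite ?mulr1 ?mulr0.
have mS k : measurable_fun setT (smear beta K (e k) (m k)).
  exact: measurable_smear.
pose D y := (((3 * C) ^+ n)%:E * `|(EFin \o F) y|)%E.
have iD : mu.-integrable setT (D \_ (box (b + 2))).
  apply/(integrable_mkcond _ (measurable_cbox _ _)).
  apply: integrableZl; first exact: measurable_cbox.
  by apply: integrable_abse; exact: iF.
have [//|||||_ _] := @dominated_convergence _ _ _ mu setT measurableT
    (fun k y => (F y * smear beta K (e k) (m k) y)%:E)
    (fun y => (F y * \1_K y)%:E) (D \_ (box (b + 2))).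
- move=> k; apply/measurable_EFinP; exact: measurable_funM.
- apply/measurable_EFinP; apply: measurable_funM => //.
- apply: nearW => y _; apply: cvg_EFin; first exact: nearW.
  apply: cvgM; first exact: cvg_cst.
  apply: smear_cvg => //.
  by move=> z /Kb /boxP.
- exact: iD.
- apply: nearW => y k _; rewrite patchE; case: ifPn.
    move=> _; rewrite /D /= -EFinM lee_fin normrM mulrC ler_wpM2r//.
    exact: smear_le.
  rewrite notin_setE => nb.
  have [->|/smear_box/nb//] := eqVneq (smear beta K (e k) (m k) y) 0.
  by rewrite mulr0 abse0.
exact.
Qed.

End smear_integral.

(** The same grid carries two partitions of unity, the smooth one and the one
    made of half-open cells.  The first is estimated member by member, and the
    resulting sum of cell volumes is the integral of the second; both converge
    to the indicator of K. *)
Lemma closed_average (F : 'rV[R]_n -> R) (K : set 'rV[R]_n) (b : R) :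
  measurable_fun setT F -> box_integrable F -> bump_averages_le F ->
  closed K -> measurable K -> K `<=` box b ->
  (`|\int[mu]_(y in K) (F y)%:E| <= M%:E * mu K)%E.
Proof.
move=> mF iF avgF cK mK Kb.
have [C C1 hC] := @profile_bound R.
have C0 : 0 <= C by lra.
have bump_le t : `|unit_bump t| <= C by case: (hC t).
have cell_le (t : R) : `|unit_cell t| <= 1.
  by rewrite ger0_norm ?unit_cell_ge0// /unit_cell; case: (_ && _); rewrite ?ler01.
have mbump := @measurable_unit_bump R.
have mcell : measurable_fun [set: R] (@unit_cell R).
  have -> : @unit_cell R = \1_(`[0, 1[%classic).
    by apply/funext => t; rewrite indicE /unit_cell mem_setE in_itv.
  exact: measurable_indic.
have m1 : measurable_fun [set: 'rV[R]_n] (fun=> 1 : R) by exact: measurable_cst.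
have [m hm] := exists_grid_size b.
have cvF := cvg_integral_smear C0 unit_bump_out bump_le (@sum_unit_bump R)
  mbump mF iF cK mK Kb hm.
have cv1 := cvg_integral_smear ler01 unit_cell_out cell_le (@sum_unit_cell R)
  mcell m1 box_integrable_cst1 cK mK Kb hm.
rewrite integral_cst// mul1e in cv1.
have cva :
    `|\int[mu]_y (F y * smear unit_bump K (e k) (m k) y)%:E|%E
      @[k --> \oo] --> `|\int[mu]_(y in K) (F y)%:E|%E by exact: cvg_abse.
have cvM := @cvgeZl _ _ _ _ _ M%:E isT cv1.
rewrite -(cvg_lim _ cva)// -(cvg_lim _ cvM)//; apply: lee_lim.
- by apply/cvg_ex; eexists; exact: cva.
- by apply/cvg_ex; eexists; exact: cvM.
apply: nearW => k /=.
rewrite (integral_smear unit_bump_out bump_le mbump)//.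
rewrite (integral_smear unit_cell_out cell_le mcell K m1 box_integrable_cst1).
rewrite ge0_sume_distrr; last first.
  move=> f _; under eq_integral do rewrite mul1r.
  rewrite integral_grid_cell// lee_fin; apply: prodr_ge0 => i _.
  exact/ltW/e_gt0.
apply: le_trans (lee_abs_sum _ _ _) _; apply: lee_sum => f _.
under [X in (_ * X)%E]eq_integral do rewrite mul1r.
by rewrite integral_grid_cell// -EFinM; exact: avgF.
Qed.

Lemma measurable_superlevel (F : 'rV[R]_n -> R) (b c : R) :
  measurable_fun setT F -> measurable (box b `&` [set y | c < F y]).
Proof.
move=> mF; apply: measurableI; first exact: measurable_cbox.
rewrite (_ : [set y | c < F y] = F @^-1` `]c, +oo[%classic).
  by rewrite -[X in measurable X]setTI; apply: mF => //; exact: measurable_itv.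
by apply/seteqP; split => y /=; rewrite in_itv/= andbT.
Qed.

(** If F exceeded 2 M on a set of positive measure, it would do so on a closed
    subset K of positive measure, where the integral of F would be at least
    2 M mu(K), against [closed_average]. *)
Lemma measure_gt_double0 (F : 'rV[R]_n -> R) (b : R) :
  measurable_fun setT F -> box_integrable F -> bump_averages_le F ->
  mu (box b `&` [set y | 2 * M < F y]) = 0%E.
Proof.
move=> mF iF avgF; set A := _ `&` _.
have mbox : measurable (box b : set 'rV[R]_n) by exact: measurable_cbox.
have mA : measurable A by exact: measurable_superlevel.
apply/eqP; rewrite -measure_le0 leNgt; apply/negP => A0.
have AD : A `<=` box b by move=> y [].
have [K [cK mK KA K0]] := closed_subset_gt0 mbox (lebesgue_box_lty b) mA AD A0.
have Kb : K `<=` box b by move=> y /KA [].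
have Kfin : mu K \is a fin_num.
  rewrite ge0_fin_numE//; apply: le_lt_trans (lebesgue_box_lty b).
  by apply: le_measure; rewrite ?inE.
have iFK : mu.-integrable K (EFin \o F) by exact: (integrableS mbox).
have := closed_average mF iF avgF cK mK Kb; apply/negP; rewrite -ltNge.
apply: (@lt_le_trans _ _ ((2 * M)%:E * mu K)%E).
  by rewrite -(fineK Kfin) -!EFinM lte_fin ltr_pM2r ?ltr_pMl ?ltr1n//
    -lte_fin fineK.
rewrite -(integral_cst mu mK).
apply: le_trans (lee_abs _).
apply: le_integral => //.
  apply/integrableP; split; first exact: measurable_cst.
  rewrite integral_cst//; apply: lte_mul_pinfty => //.
  by rewrite -ge0_fin_numE.
by move=> y /set_mem /KA[_] /= /ltW; rewrite lee_fin.
Qed.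

(** The bound on averages is symmetric under F -> - F, so both super-level
    sets are null in every box. *)
Lemma ae_le_double (F : 'rV[R]_n -> R) :
  measurable_fun setT F -> box_integrable F -> bump_averages_le F ->
  {ae mu, forall y, `|F y| <= 2 * M}.
Proof.
move=> mF iF avgF.
have mNF : measurable_fun setT (fun y => - F y) by exact: measurableT_comp.
have iNF : box_integrable (fun y => - F y).
  move=> a; have := iF a => /(integrableN); apply: eq_integrable => //.
  exact: measurable_cbox.
have avgNF : bump_averages_le (fun y => - F y).
  move=> k s; under eq_integral do rewrite mulNr EFinN.
  have [C C1 hC] := @profile_bound R.
  rewrite integralN ?abseN; first exact: avgF.
  have bC (t : R) : `|unit_bump t| <= C by case: (hC t).
  apply: integrable_add_def => //.
  exact: (integrable_grid_fun unit_bump_out bC (@measurable_unit_bump R) mF iF).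
pose A k := (box k%:R `&` [set y | 2 * M < F y]) `|`
            (box k%:R `&` [set y | 2 * M < - F y]).
suff : mu.-negligible (\bigcup_k A k).
  apply: negligibleS => y /= /negP; rewrite -ltNge => h.
  exists (\max_i Num.bound `|y ord0 i|) => //.
  have yb : box (\max_i Num.bound `|y ord0 i|)%:R y.
    apply/boxP => i; apply/ltW.
    apply: lt_le_trans (archi_boundP (normr_ge0 _)) _.
    by rewrite ler_nat (@leq_bigmax _ (fun i => Num.bound `|y ord0 i|)).
  by move: h; rewrite ltr_normr => /orP[h|h]; [left|right].
apply: negligible_bigcup => k; apply: negligibleU.
  exists (box k%:R `&` [set y | 2 * M < F y]); split => //.
    exact: measurable_superlevel.
  exact: measure_gt_double0.
exists (box k%:R `&` [set y | 2 * M < - F y]); split => //.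
  exact: measurable_superlevel.
exact: measure_gt_double0.
Qed.

End closed_average.

(** * Product mollifiers and the primitives of their differences *)

Section mollifier.
Context {R : realType}.
Implicit Types c e t : R.

Definition mollifier1 c e t : R := e^-1 * unit_bump (e^-1 * t + - (c / e)).

(** The primitive of [mollifier1 c e - mollifier1 c e']; it vanishes far from
    c on both sides because the two mollifiers have the same integral. *)
Definition ramp_diff c e e' t : R :=
  profile (e^-1 * t + - (c / e)) + (-1) * profile (e'^-1 * t + - (c / e')).

Lemma smooth1_mollifier1 c e : smooth1 (mollifier1 c e).
Proof.
move=> m; apply: CkM; first exact: Ck_cst.
by apply: Ck_affine; exact: smooth1_derive smooth1_profile m.
Qed.

Lemma smooth1_ramp_diff c e e' : smooth1 (ramp_diff c e e').
Proof.
move=> m; apply: CkD; first by apply: Ck_affine; exact: smooth1_profile.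
apply: CkM; first exact: Ck_cst.
by apply: Ck_affine; exact: smooth1_profile.
Qed.

Lemma derive_profile_affine c e t :
  is_derive t (1 : R) (fun t => profile (e^-1 * t + - (c / e))) (mollifier1 c e t).
Proof.
rewrite /mollifier1 [e^-1 * unit_bump _]mulrC.
apply: (@is_derive1_comp _ profile (fun t : R => e^-1 * t + - (c / e))).
  exact: CkSP (smooth1_profile 1) _.
by apply: is_derive_eq; rewrite /GRing.scale/= mulr1 ?oppr0 addr0.
Qed.

Lemma derive_ramp_diff c e e' :
  derive1 (ramp_diff c e e') = fun t => mollifier1 c e t - mollifier1 c e' t.
Proof.
apply: is_derive_derive1 => t.
have d1 := derive_profile_affine c e t.
have d2 := @is_deriveZ _ _ _ _ (-1) _ _ _ (derive_profile_affine c e' t).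
apply: (is_derive_eq (is_deriveD d1 d2)).
by rewrite scaleN1r.
Qed.

Lemma affine_div c e t : e^-1 * t + - (c / e) = (t - c) / e.
Proof. by rewrite mulrBl mulrC. Qed.

Lemma mollifier1_out c e t : 0 < e -> e < `|t - c| -> mollifier1 c e t = 0.
Proof.
move=> e0 h; rewrite /mollifier1 affine_div unit_bump_out ?mulr0//.
by rewrite normf_div (gtr0_norm e0) ltr_pdivlMr// mul1r.
Qed.

Lemma ramp_diff_out c e e' t : 0 < e' -> e' <= e -> e < `|t - c| ->
  ramp_diff c e e' t = 0.
Proof.
move=> e'0 ee h; have e0 : 0 < e by lra.
have h' := le_lt_trans ee h.
rewrite /ramp_diff !affine_div.
have [tc|tc] := leP 0 (t - c).
  rewrite ger0_norm// in h h'.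
  by rewrite !profile1 ?mulr1 ?subrr// ler_pdivlMr// mul1r ltW.
rewrite ltr0_norm// in h h'.
by rewrite !profile0 ?mulr0 ?addr0// ler_pdivrMr//; lra.
Qed.

End mollifier.

Section product_mollifier.
Context {R : realType} {n : nat}.
Local Notation mu := (lebesgue_rV R n).
Variable C : R.
Hypotheses (C1 : 1 <= C)
  (hC : forall t : R, `|profile t| <= C /\ `|unit_bump t| <= C).
Implicit Types (c e w : 'I_n -> R).

Let C_ge0 : 0 <= C.
Proof. exact: le_trans ler01 C1. Qed.

Definition mollifier c e : 'rV[R]_n -> R :=
  tensor (fun j => mollifier1 (c j) (e j)).

Lemma tensor_le (g : 'I_n -> R -> R) (B : 'I_n -> R) y :
  (forall j t, `|g j t| <= B j) -> `|tensor g y| <= \prod_j B j.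
Proof.
move=> gB; rewrite /tensor normr_prod; apply: ler_prod => j _.
by rewrite normr_ge0 gB.
Qed.

Lemma tensor_out (g : 'I_n -> R -> R) c w y :
  (forall j t, w j < `|t - c j| -> g j t = 0) -> ~ cbox c w y -> tensor g y = 0.
Proof.
move=> gout nB; have [j hj] : exists j, w j < `|y ord0 j - c j|.
  apply: contrapT => h; apply: nB; apply/cboxP => i; rewrite leNgt.
  by apply/negP => hi; apply: h; exists i.
by rewrite (tensorD1 _ j) gout// mul0r.
Qed.

Lemma mollifier1_le (a d t : R) : 0 < d -> `|mollifier1 a d t| <= C / d.
Proof.
move=> d0; rewrite /mollifier1 normrM gtr0_norm ?invr_gt0// mulrC.
rewrite ler_wpM2r ?invr_ge0; [by []|exact: ltW|].
by case: (hC (d^-1 * t + - (a / d))).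
Qed.

(** Up to the volume factor, a mollifier is a member of the grid partition of
    unity with node c / e. *)
Lemma mollifier_grid_fun c e y :
  mollifier c e y = (\prod_j e j)^-1 * grid_fun unit_bump e (fun j => c j / e j) y.
Proof.
rewrite /mollifier /grid_fun /tensor -prodfV -big_split/=.
by apply: eq_bigr => j _; rewrite /mollifier1 [y ord0 j / e j]mulrC.
Qed.

Lemma measurable_mollifier c e : measurable_fun setT (mollifier c e).
Proof.
apply: measurable_tensor => i; apply: continuous_measurable_fun.
exact: smooth1_continuous (smooth1_mollifier1 _ _).
Qed.

Lemma mollifier_pairing (r b : R) (F : 'rV[R]_n -> R) c e :
  1 < r -> measurable_fun setT F -> Lnorm mu r%:E (EFin \o F) = b%:E ->
  (forall i, 0 < e i) ->
  mu.-integrable setT (fun y => (F y * mollifier c e y)%:E) /\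
  (`|\int[mu]_y (F y * mollifier c e y)%:E| <=
    (C ^+ n / \prod_i e i * (b * (\prod_i (2 * e i)) `^ (1 - r^-1)))%:E)%E.
Proof.
move=> r1 mF Fb e0.
apply: (pairing_bound r1 _ mF (measurable_cbox c e) Fb).
- apply: divr_ge0; first exact: exprn_ge0.
  by apply: prodr_ge0 => i _; exact/ltW/e0.
- by apply: lebesgue_cbox => i; exact/ltW/e0.
- exact: measurable_mollifier.
- move=> y _.
  apply: le_trans (tensor_le _ (fun j t => mollifier1_le (c j) t (e0 j))) _.
  by rewrite big_split/= prodr_const card_ord prodfV.
- by move=> y; apply: tensor_out => j t; exact: mollifier1_out.
Qed.

(** Intermediate scales between e and e', chosen so that two consecutive
    mollifiers differ in a single factor. *)
Definition hybrid e e' (s : nat) : 'I_n -> R :=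
  fun j => if (j < s)%N then e' j else e j.

(** Consecutive hybrid mollifiers differ in their i-th factor only, so their
    difference is the i-th derivative of the product in which that factor is
    replaced by the primitive [ramp_diff]. *)
Definition primitive_factor c e e' (i : 'I_n) : 'I_n -> R -> R :=
  replace (fun j => mollifier1 (c j) (hybrid e e' i j)) i
    (ramp_diff (c i) (e i) (e' i)).

Definition primitive c e e' (i : 'I_n) : 'rV[R]_n -> R :=
  tensor (primitive_factor c e e' i).

Lemma smooth1_primitive_factor c e e' i j : smooth1 (primitive_factor c e e' i j).
Proof.
apply: smooth_replace; last exact: smooth1_ramp_diff.
by move=> k; exact: smooth1_mollifier1.
Qed.

Section primitive_properties.
Variables (c e e' : 'I_n -> R).
Hypotheses (e'_gt0 : forall j, 0 < e' j) (e'_le : forall j, e' j <= e j)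
  (e_le : forall j, e j <= 2 * e' j).

Let e_gt0 j : 0 < e j.
Proof. exact: lt_le_trans (e'_gt0 j) (e'_le j). Qed.

Lemma primitive_factor_out i j t : e j < `|t - c j| ->
  primitive_factor c e e' i j t = 0.
Proof.
move=> h; rewrite /primitive_factor /replace; case: eqVneq => [ji|_].
  by rewrite -ji; exact: ramp_diff_out.
apply: mollifier1_out; rewrite /hybrid; case: ifP => // _.
exact: le_lt_trans (e'_le j) h.
Qed.

Lemma test_function_primitive i : test_function (primitive c e e' i).
Proof.
apply: (test_function_tensor (a := fun j => c j - e j) (b := fun j => c j + e j)).
  exact: smooth1_primitive_factor.
move=> j t; apply: contra_neqT => h; apply: (primitive_factor_out i).
by move: h; rewrite -ler_distl ltNge.
Qed.

(** Off the i-th coordinate the hybrids of ranks i and i + 1 agree, so the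
    common factors of the two mollifiers can be taken out. *)
Lemma pderiv_primitive i : pderiv i (primitive c e e' i) =
  fun y => mollifier c (hybrid e e' i) y - mollifier c (hybrid e e' i.+1) y.
Proof.
rewrite /primitive pderiv_tensor; last exact: smooth1_primitive_factor.
apply/funext => y.
rewrite tensor_replace {1}/primitive_factor {1}/replace eqxx.
rewrite derive_ramp_diff mulrBl.
have kE s : mollifier c (hybrid e e' s) y =
    mollifier1 (c i) (hybrid e e' s i) (y ord0 i) *
    \prod_(j | j != i) mollifier1 (c j) (hybrid e e' s j) (y ord0 j).
  exact: tensorD1.
have h1 : hybrid e e' i i = e i by rewrite /hybrid ltnn.
have h2 : hybrid e e' i.+1 i = e' i by rewrite /hybrid ltnSn.
have h3 j : j != i -> hybrid e e' i.+1 j = hybrid e e' i j.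
  move=> /negPf ji; rewrite /hybrid ltnS.
  by rewrite [(j <= i)%N]leq_eqVlt (inj_eq val_inj) ji.
rewrite !kE h1 h2; under [in RHS]eq_bigr => j ji do rewrite -h3//.
under eq_bigr => j ji do rewrite /primitive_factor /replace (negPf ji) -h3//.
by [].
Qed.

(** Every factor other than the i-th contributes 2 C / e_j, while the i-th is
    bounded by 2 C without any division by e_i: this gain of one power of e_i
    is what the derivative buys. *)
Lemma primitive_le i y :
  `|primitive c e e' i y| <= (2 * C) ^+ n * (e i / \prod_j e j).
Proof.
pose B j := 2 * C * (if j == i then 1 else (e j)^-1).
apply: (@le_trans _ _ (\prod_j B j)).
  apply: tensor_le => j t; rewrite /B /primitive_factor /replace; case: ifP => _.
    rewrite mulr1 /ramp_diff; apply: le_trans (ler_normD _ _) _.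
    rewrite mulN1r normrN.
    have [+ _] := hC ((e i)^-1 * t + - (c i / e i)).
    by have [+ _] := hC ((e' i)^-1 * t + - (c i / e' i)); lra.
  (* A hybrid scale may be the smaller one, whence the factor 2. *)
  have h0 : 0 < hybrid e e' i j by rewrite /hybrid; case: ifP.
  apply: le_trans (mollifier1_le _ _ h0) _.
  rewrite ler_pdivrMr// mulrAC ler_pdivlMr// -mulrA mulrCA.
  apply: ler_wpM2l => //.
  by rewrite /hybrid; have := e'_le j; have := e'_gt0 j; case: ifP => // _; lra.
rewrite /B big_split/= prodr_const card_ord.
apply: ler_wpM2l; first by rewrite exprn_ge0 ?mulr_ge0.
rewrite (bigD1 i)//= eqxx mul1r [\prod_j e j](bigD1 i)//= invfM mulrA.
rewrite divff ?lt0r_neq0// mul1r -prodfV.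
by rewrite le_eqVlt; apply/orP; left; apply/eqP; apply: eq_bigr => j /negPf ->.
Qed.

Lemma primitive_pairing (q b : R) (G : 'rV[R]_n -> R) i :
  1 < q -> measurable_fun setT G -> Lnorm mu q%:E (EFin \o G) = b%:E ->
  (`|\int[mu]_y (G y * primitive c e e' i y)%:E| <=
    ((2 * C) ^+ n * (e i / \prod_j e j) *
      (b * (\prod_j (2 * e j)) `^ (1 - q^-1)))%:E)%E.
Proof.
move=> q1 mG Gb.
apply: (pairing_bound q1 _ mG (measurable_cbox c e) Gb _ _ _ _).2.
- apply: mulr_ge0; first by rewrite exprn_ge0 ?mulr_ge0.
  by apply: divr_ge0; [exact/ltW|apply: prodr_ge0 => j _; exact/ltW].
- by apply: lebesgue_cbox => j; exact/ltW.
- apply: measurable_tensor => j; apply: continuous_measurable_fun.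
  exact: smooth1_continuous (smooth1_primitive_factor c e e' i j).
- by move=> y _; exact: primitive_le.
- by move=> y; apply: tensor_out => j t; exact: primitive_factor_out.
Qed.

End primitive_properties.

End product_mollifier.

(** * Oscillation of averages across scales *)

Section scales.
Context {R : realType}.
Implicit Types d g : R.

Lemma powR1r g : 1 `^ g = 1 :> R.
Proof. by rewrite powR1. Qed.

Lemma powR_half_le1 g : 0 <= g -> (2^-1 : R) `^ g <= 1.
Proof.
move=> g0; rewrite -[leRHS](powR1r g); apply: ge0_ler_powR => //.
- by rewrite nnegrE invr_ge0.
- by rewrite nnegrE.
- by rewrite invf_le1 ?ler1n.
Qed.

Lemma powR_half_ge g : g <= 1 -> (2^-1 : R) <= 2^-1 `^ g.
Proof.
move=> g1; rewrite -[in leRHS]powR_inv1// -powRrM mulN1r -[leLHS]powR_inv1//.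
by apply: ler_powR; [exact: ler1n|rewrite lerN2].
Qed.

Lemma powR_half_lt1 g : 0 < g -> (2^-1 : R) `^ g < 1.
Proof.
move=> g0; rewrite -[ltRHS](powR1r g); apply: gt0_ltr_powR => //.
- by rewrite nnegrE invr_ge0.
- by rewrite nnegrE.
- by rewrite invf_lt1 ?ltr1n.
Qed.

Lemma powR_scale d g k : 0 <= d -> (d * 2^-1 ^+ k) `^ g = d `^ g * (2^-1 `^ g) ^+ k.
Proof.
move=> d0; rewrite powRM ?exprn_ge0 ?invr_ge0//.
congr (_ * _).
have h : 0 <= 2^-1 :> R by rewrite invr_ge0.
by rewrite -(powR_mulrn _ h) -powRrM mulrC powRrM powR_mulrn// powR_ge0.
Qed.

Lemma powRD_gt0 d g h : 0 < d -> d `^ (g + h) = d `^ g * d `^ h.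
Proof. by move=> d0; apply: powRD; rewrite (gt_eqF d0) implybT. Qed.

Lemma prodr_powR (I : finType) d (a : I -> R) : 0 < d ->
  \prod_i d `^ a i = d `^ (\sum_i a i).
Proof.
move=> d0; apply/esym/(big_morph (fun x => d `^ x)); last exact: powRr0.
by move=> x y; exact: powRD_gt0.
Qed.

Lemma sum_decrements n (u : nat -> R) :
  \sum_(i < n) (u i - u i.+1) = u 0%N - u n.
Proof.
rewrite -(opprB (u n)) -(telescope_sumr u (leq0n n)) -sumrN big_mkord.
by apply: eq_bigr => i _; rewrite opprB.
Qed.

End scales.

Section oscillation.
Context {R : realType} {n : nat}.
Local Notation mu := (lebesgue_rV R n).
Variables (C : R) (p : 'I_n -> R) (r : R).
Variables (F : 'rV[R]_n -> R) (G : 'I_n -> 'rV[R]_n -> R).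
Variables (bF : R) (bG : 'I_n -> R).
Hypotheses (C1 : 1 <= C)
  (hC : forall t : R, `|profile t| <= C /\ `|unit_bump t| <= C).
Hypotheses (p_gt1 : forall i, 1 < p i) (r_gt1 : 1 < r).
Hypotheses (mF : measurable_fun setT F)
  (mG : forall i, measurable_fun setT (G i)).
Hypothesis Fb : Lnorm mu r%:E (EFin \o F) = bF%:E.
Hypothesis Gb : forall i, Lnorm mu (p i)%:E (EFin \o G i) = (bG i)%:E.
Hypothesis weak : forall i (f : 'I_n -> R -> R),
  (forall j, smooth1 (f j)) -> test_function (tensor f) ->
  (\int[mu]_y (F y * pderiv i (tensor f) y)%:E =
   - \int[mu]_y (G i y * tensor f y)%:E)%E.
Implicit Types (c e : 'I_n -> R).

Definition average c e : R := fine (\int[mu]_y (F y * mollifier c e y)%:E).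

Lemma integrable_mollifier c e : (forall i, 0 < e i) ->
  mu.-integrable setT (fun y => (F y * mollifier c e y)%:E).
Proof. by move=> e0; have [] := mollifier_pairing C1 hC c r_gt1 mF Fb e0. Qed.

Lemma averageE c e : (forall i, 0 < e i) ->
  ((average c e)%:E = \int[mu]_y (F y * mollifier c e y)%:E)%E.
Proof.
by move=> e0; rewrite fineK// integrable_fin_num//; exact: integrable_mollifier.
Qed.

Lemma average_le c e : (forall i, 0 < e i) ->
  `|average c e| <=
    C ^+ n / \prod_i e i * (bF * (\prod_i (2 * e i)) `^ (1 - r^-1)).
Proof.
move=> e0; rewrite -lee_fin -abse_EFin averageE//.
by have [] := mollifier_pairing C1 hC c r_gt1 mF Fb e0.
Qed.

(** The bound of [primitive_pairing] for the i-th coordinate. *)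
Definition osc_term e (i : 'I_n) : R := (2 * C) ^+ n * (e i / \prod_j e j) *
  (bG i * (\prod_j (2 * e j)) `^ (1 - (p i)^-1)).

Section two_scales.
Variables (c e e' : 'I_n -> R).
Hypotheses (e'_gt0 : forall j, 0 < e' j) (e'_le : forall j, e' j <= e j)
  (e_le : forall j, e j <= 2 * e' j).

Lemma average_step (i : 'I_n) :
  `|average c (hybrid e e' i) - average c (hybrid e e' i.+1)| <= osc_term e i.
Proof.
have h0 s j : 0 < hybrid e e' s j.
  by rewrite /hybrid; case: ifP => // _; exact: lt_le_trans (e'_le j).
have dE : ((average c (hybrid e e' i) - average c (hybrid e e' i.+1))%:E =
    \int[mu]_y (F y * pderiv i (primitive c e e' i) y)%:E)%E.
  rewrite EFinB.
  apply: (eq_trans (congr2 (fun x y => x - y)%E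
    (averageE c (h0 i)) (averageE c (h0 i.+1)))).
  rewrite -(integralB _ (integrable_mollifier c (h0 i))
    (integrable_mollifier c (h0 i.+1)))//.
  by apply: eq_integral => y _; rewrite pderiv_primitive -EFinB -mulrBr.
rewrite -lee_fin -abse_EFin dE.
rewrite weak ?abseN; last exact: test_function_primitive.
  2: by move=> j; exact: smooth1_primitive_factor.
exact: (primitive_pairing C1 hC _ e'_gt0 e'_le e_le i (p_gt1 i) (mG i) (Gb i)).
Qed.

(** Move from e to e' one coordinate at a time through the hybrid scales. *)
Lemma average_osc : `|average c e - average c e'| <= \sum_i osc_term e i.
Proof.
have hyb0 : hybrid e e' 0 = e by apply/funext => j; rewrite /hybrid ltn0.
have hybn : hybrid e e' n = e' by apply/funext => j; rewrite /hybrid ltn_ord.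
have := sum_decrements n (fun s => average c (hybrid e e' s)).
rewrite hyb0 hybn => <-; apply: le_trans (ler_norm_sum _ _ _) _.
by apply: ler_sum => i _; exact: average_step.
Qed.

End two_scales.

Section dilations.
Variables (a : 'I_n -> R) (g : R).
Hypotheses (g_gt0 : 0 < g) (aE : forall i, a i = (p i)^-1 + g)
  (sum_a : \sum_i a i = 1).

(** The anisotropic dilation adapted to the exponents: the box of scale d has
    volume comparable to d, because the exponents sum to 1. *)
Definition dilation (d : R) : 'I_n -> R := fun i => d `^ a i.

Lemma exponent_gt0 i : 0 < a i.
Proof. by rewrite aE addr_gt0// invr_gt0; exact: lt_trans (p_gt1 i). Qed.

Lemma exponent_le1 i : a i <= 1.
Proof.
rewrite -sum_a (bigD1 i)//= lerDl; apply: sumr_ge0 => j _.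
exact/ltW/exponent_gt0.
Qed.

Lemma dilation_gt0 d i : 0 < d -> 0 < dilation d i.
Proof. exact: powR_gt0. Qed.

Lemma prod_dilation d : 0 < d -> \prod_i dilation d i = d.
Proof. by move=> d0; rewrite prodr_powR// sum_a powRr1 ?ltW. Qed.

Lemma prod_double_dilation (d s : R) : 0 < d -> 1 < s ->
  (\prod_i (2 * dilation d i)) `^ (1 - s^-1) <= 2 ^+ n * d `^ (1 - s^-1).
Proof.
move=> d0 s1; rewrite big_split/= prodr_const card_ord prod_dilation//.
have s0 : 0 < s by lra.
rewrite powRM ?exprn_ge0 ?(ltW d0)// ler_wpM2r ?powR_ge0//.
rewrite -[leRHS]powRr1 ?exprn_ge0//; apply: ler_powR.
  by rewrite exprn_ege1// ler1n.
by rewrite lerBlDr lerDl invr_ge0 ltW.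
Qed.

(** d^(a_i) / d * d^(1 - 1/p_i) = d^g whatever i is; this is what dictates
    a_i = 1/p_i + g. *)
Lemma osc_term_dilation (d : R) i : 0 < d -> 0 <= bG i ->
  osc_term (dilation d) i <= (4 * C) ^+ n * bG i * d `^ g.
Proof.
move=> d0 b0; rewrite /osc_term prod_dilation//.
have C0 : 0 <= C by exact: le_trans ler01 C1.
apply: (@le_trans _ _ ((2 * C) ^+ n * (dilation d i / d) *
    (bG i * (2 ^+ n * d `^ (1 - (p i)^-1))))).
  apply: ler_wpM2l.
    apply: mulr_ge0; first by rewrite exprn_ge0// mulr_ge0.
    by apply: divr_ge0; [exact: powR_ge0|exact: ltW].
  by apply: ler_wpM2l => //; exact: prod_double_dilation.
have -> : d `^ g = dilation d i / d * d `^ (1 - (p i)^-1).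
  rewrite /dilation -[X in _ / X](powRr1 (ltW d0)) -powRN -!powRD_gt0//.
  by congr (_ `^ _); rewrite aE; lra.
have -> : (4 * C) ^+ n = (2 * C) ^+ n * 2 ^+ n.
  by rewrite -exprMn; congr (_ ^+ _); lra.
by rewrite le_eqVlt; apply/orP; left; apply/eqP; ring.
Qed.

Hypothesis bG_ge0 : forall i, 0 <= bG i.

Let A := (4 * C) ^+ n * \sum_i bG i.
Let q : R := 2^-1 `^ g.

Let A_ge0 : 0 <= A.
Proof.
apply: mulr_ge0; last exact: sumr_ge0.
by rewrite exprn_ge0// mulr_ge0//; exact: le_trans ler01 C1.
Qed.

(** Halving d keeps the sides within a factor 2 of the old ones, since the
    exponents lie between 0 and 1. *)
Lemma average_halve c (d : R) : 0 < d ->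
  `|average c (dilation d) - average c (dilation (d * 2^-1))| <= A * d `^ g.
Proof.
move=> d0; have d2 : 0 < d * 2^-1 by rewrite mulr_gt0 ?invr_gt0.
have dE i : dilation (d * 2^-1) i = dilation d i * 2^-1 `^ a i.
  by rewrite /dilation powRM ?ltW// invr_ge0.
apply: le_trans (average_osc c _ _ _) _.
- by move=> j; exact: dilation_gt0.
- move=> j; rewrite dE ler_piMr ?powR_ge0//.
  exact/powR_half_le1/ltW/exponent_gt0.
- move=> j; rewrite dE mulrCA ler_peMr ?powR_ge0//.
  by rewrite -ler_pdivrMl// mulr1 powR_half_ge// exponent_le1.
rewrite /A -mulrA mulr_suml mulr_sumr; apply: ler_sum => i _.
by rewrite mulrA; exact: osc_term_dilation.
Qed.

(** The oscillations over successive halvings decay geometrically with ratio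
    2^(-g), so they sum to a bound independent of k. *)
Lemma average_scale c (d : R) k : 0 < d ->
  `|average c (dilation d) - average c (dilation (d * 2^-1 ^+ k))| <=
    A * d `^ g / (1 - q).
Proof.
move=> d0; have q1 : q < 1 by exact: powR_half_lt1.
have q0 : 0 <= q by exact: powR_ge0.
have q2 : 0 < 1 - q by rewrite subr_gt0.
apply: (@le_trans _ _ (A * d `^ g * \sum_(i < k) q ^+ i)); last first.
  apply: ler_wpM2l; first by rewrite mulr_ge0 ?powR_ge0.
  rewrite -[leRHS]mul1r ler_pdivlMr// -opprB mulrN mulrC -subrX1 opprB.
  by rewrite lerBlDr lerDl exprn_ge0.
elim: k => [|k IH]; first by rewrite expr0 mulr1 subrr normr0 big_ord0 mulr0.
rewrite big_ord_recr/= mulrDr.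
have dk : 0 < d * 2^-1 ^+ k by rewrite mulr_gt0// exprn_gt0 ?invr_gt0.
have h := average_halve c dk.
rewrite powR_scale ?(ltW d0)// -/q mulrA in h.
have dS : d * 2^-1 ^+ k * 2^-1 = d * 2^-1 ^+ k.+1 by rewrite exprSr mulrA.
rewrite dS in h.
apply: le_trans (ler_distD (average c (dilation (d * 2^-1 ^+ k))) _ _) _.
exact: lerD.
Qed.

Lemma average_bound c (d : R) k : 0 < d -> 0 <= bF ->
  `|average c (dilation (d * 2^-1 ^+ k))| <=
    (2 * C) ^+ n * bF * d `^ (- r^-1) + A * d `^ g / (1 - q).
Proof.
move=> d0 b0.
have C0 : 0 <= C by exact: le_trans ler01 C1.
have h := average_scale c k d0.
have h2 : `|average c (dilation d)| <= (2 * C) ^+ n * bF * d `^ (- r^-1).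
  apply: le_trans (average_le _ _) _; first by move=> i; exact: dilation_gt0.
  rewrite prod_dilation//.
  apply: (@le_trans _ _ (C ^+ n / d * (bF * (2 ^+ n * d `^ (1 - r^-1))))).
    apply: ler_wpM2l; first by rewrite divr_ge0 ?exprn_ge0 ?(ltW d0).
    by apply: ler_wpM2l => //; exact: prod_double_dilation.
  have -> : d `^ (- r^-1) = d^-1 * d `^ (1 - r^-1).
    rewrite -(powR_inv1 (ltW d0)) -powRD_gt0//.
    by congr (_ `^ _); lra.
  by rewrite exprMn le_eqVlt; apply/orP; left; apply/eqP; ring.
rewrite -[X in `|X|](subKr (average c (dilation d))).
by apply: le_trans (ler_normB _ _) _; exact: lerD.
Qed.

Lemma box_integrable_Lnorm : box_integrable F.
Proof.
move=> b; apply/integrableP; split.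
  by apply/measurable_EFinP; exact: measurable_funTS.
have bfin : mu (box b) \is a fin_num.
  by rewrite ge0_fin_numE//; exact: lebesgue_box_lty.
apply: le_lt_trans (integral_abs_Lnorm_le r_gt1 mF (measurable_cbox _ _) Fb
  (esym (fineK bfin))) _.
exact: ltry.
Qed.

Lemma bump_averages_dilation (d M : R) : 0 < d -> 0 <= bF ->
  (2 * C) ^+ n * bF * d `^ (- r^-1) + A * d `^ g / (1 - q) <= M ->
  bump_averages_le (fun k => dilation (d * 2^-1 ^+ k)) M F.
Proof.
move=> d0 b0 hM k s.
set e := dilation _.
have dk : 0 < d * 2^-1 ^+ k by rewrite mulr_gt0// exprn_gt0 ?invr_gt0.
have e0 i : 0 < e i by exact: dilation_gt0.
have P0 : 0 < \prod_i e i by exact: prodr_gt0.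
pose c i := e i * s i.
have cE : (fun j => c j / e j) = s.
  by apply/funext => j; rewrite /c mulrC mulKf// gt_eqF.
have -> : (\int[mu]_y (F y * grid_fun unit_bump e s y)%:E =
    (\prod_i e i)%:E * \int[mu]_y (F y * mollifier c e y)%:E)%E.
  rewrite -integralZl//; last exact: integrable_mollifier.
  apply: eq_integral => y _; rewrite -EFinM mollifier_grid_fun cE; congr EFin.
  by rewrite mulrCA (mulrA (\prod_i e i)) divff ?gt_eqF// mul1r.
rewrite -averageE// -EFinM abse_EFin lee_fin normrM gtr0_norm// mulrC.
apply: ler_wpM2r; first exact: ltW.
exact: le_trans (average_bound c k d0 b0) hM.
Qed.

Lemma ae_bound_dilation (d M : R) : 0 < d -> d <= 1 -> 0 <= bF -> 0 < M ->
  (2 * C) ^+ n * bF * d `^ (- r^-1) + A * d `^ g / (1 - q) <= M ->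
  {ae mu, forall y, `|F y| <= 2 * M}.
Proof.
move=> d0 d1 b0 M0 hM.
apply: (@ae_le_double _ _ (fun k => dilation (d * 2^-1 ^+ k))) => //.
- move=> k i; apply: dilation_gt0.
  by rewrite mulr_gt0// exprn_gt0 ?invr_gt0.
- move=> k i; rewrite /dilation powR_scale ?(ltW d0)//.
  rewrite mulr_ile1 ?exprn_ge0 ?powR_ge0 ?exprn_ile1 ?powR_ge0//.
    rewrite -[leRHS](powR1r (a i)); apply: ge0_ler_powR => //.
    + exact/ltW/exponent_gt0.
    + by rewrite nnegrE ltW.
    + by rewrite nnegrE.
  exact/powR_half_le1/ltW/exponent_gt0.
- move=> i; rewrite /dilation.
  under eq_fun do rewrite powR_scale ?(ltW d0)//.
  have q0 : (fun k => (2^-1 `^ a i) ^+ k) @ \oo --> (0 : R).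
    apply: cvg_expr; rewrite ger0_norm ?powR_ge0//.
    exact/powR_half_lt1/exponent_gt0.
  have h : (fun k => d `^ a i * (2^-1 `^ a i) ^+ k) @ \oo --> d `^ a i * 0.
    by apply: cvgM => //; exact: cvg_cst.
  by rewrite mulr0 in h; exact: h.
- exact: box_integrable_Lnorm.
- exact: bump_averages_dilation.
Qed.

End dilations.

End oscillation.

(** * The logarithmic inequality *)

Section sobolev.
Context {R : realType} {n : nat}.
Local Notation mu := (lebesgue_rV R n).
Local Open Scope ereal_scope.
Implicit Types (F : 'rV[R]_n -> R) (p : 'I_n -> R).

Lemma normL_ge0 (q : \bar R) F : 0 <= normL q F.
Proof. exact: Lnorm_ge0. Qed.

Lemma normL_ae_eq (q : R) F F0 : measurable_fun setT F0 ->
  {ae mu, forall y, F y = F0 y} ->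
  Lnorm mu q%:E (EFin \o F0) = normL q%:E F.
Proof.
move=> mF0 FF0; apply/esym/Lnorm_ae_eq; first exact/measurable_EFinP.
by apply: filterS FF0 => y /= ->.
Qed.

Lemma normL_le_ess_bound F F0 (M : R) : {ae mu, forall y, F y = F0 y} ->
  {ae mu, forall y, (`|F0 y| <= M)%R} -> (0 <= M)%R -> normL +oo F <= M%:E.
Proof.
move=> FF0 F0M M0; rewrite /normL unlock.
case: ifP => [_|_]; last by rewrite lee_fin.
apply/ess_supP; apply: filterS2 FF0 F0M => y /= -> h.
by rewrite lee_fin.
Qed.

(** Only product test functions are paired with Borel representatives, because
    their measurability follows factor by factor. *)
Lemma weak_pderiv_Borel i F G F0 G0 (f : 'I_n -> R -> R) :
  weak_pderiv i F G ->
  measurable_fun setT F0 -> {ae mu, forall y, F y = F0 y} ->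
  measurable_fun setT G0 -> {ae mu, forall y, G y = G0 y} ->
  (forall j, smooth1 (f j)) -> test_function (tensor f) ->
  \int[mu]_y (F0 y * pderiv i (tensor f) y)%:E =
  - \int[mu]_y (G0 y * tensor f y)%:E.
Proof.
move=> [_ _ wFG] mF0 FF0 mG0 GG0 sf /wFG.
have mtensor (h : 'I_n -> R -> R) : (forall j, smooth1 (h j)) ->
    measurable_fun setT (tensor h).
  move=> sh; apply: measurable_tensor => j; apply: continuous_measurable_fun.
  exact: smooth1_continuous.
rewrite (@ae_eq_integral_measurable _ _ _ mu
  (fun y => (F y * pderiv i (tensor f) y)%:E)
  (fun y => (F0 y * pderiv i (tensor f) y)%:E)).
- rewrite (@ae_eq_integral_measurable _ _ _ mu (fun y => (G y * tensor f y)%:E)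
    (fun y => (G0 y * tensor f y)%:E))//.
    by apply/measurable_EFinP; apply: measurable_funM => //; exact: mtensor.
  by apply: filterS GG0 => y /= ->.
- apply/measurable_EFinP; apply: measurable_funM => //.
  rewrite pderiv_tensor//; apply: mtensor; apply: smooth_replace => //.
  exact: smooth1_derive.
- by apply: filterS FF0 => y /= ->.
Qed.

Lemma normL_le_sobolev_sum p F G i :
  normL (p i)%:E (G i) <= sobolev_sum p F G.
Proof.
rewrite /sobolev_sum (bigD1 i)//= -addeA.
apply: (@le_trans _ _ (normL (p i)%:E F + normL (p i)%:E (G i))).
  by rewrite leeDr// normL_ge0.
rewrite leeDl// adde_ge0 ?lee_fin ?expR_ge0//; apply: sume_ge0 => j _.
by rewrite adde_ge0 ?normL_ge0.
Qed.

Lemma sum_derivatives_le_sobolev_sum p F G :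
  \sum_i normL (p i)%:E (G i) + (expR 3)%:E <= sobolev_sum p F G.
Proof.
rewrite /sobolev_sum leeD2r//; apply: lee_sum => i _.
by rewrite leeDr// normL_ge0.
Qed.

Lemma normL_le_sup_normL (lambda r : R) F : (2 <= r)%R ->
  normL r%:E F * ((r * ln r) `^ lambda)^-1%:E <= sup_normL lambda F.
Proof. by move=> r2; apply: ereal_sup_ubound; exists r. Qed.

End sobolev.

Unset Implicit Arguments.

Theorem lemma2p2 (R : realType) (N : nat) (N_gt0 : (0 < N)%N)
    (p : 'I_N -> R) (p_gt1 : forall i, 1 < p i)
    (sum_p : \sum_(i < N) (p i)^-1 < 1) (lambda : R) (lambda_gt0 : 0 < lambda) :
  exists C : R,
    forall (F : 'rV[R]_N -> R) (G : 'I_N -> 'rV[R]_N -> R),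
      (forall i, weak_pderiv i F (G i)) ->
      (sobolev_sum p F G < +oo)%E ->
      (sup_normL lambda F < +oo)%E ->
      (normL +oo F <= C%:E * maxe 1 (sup_normL lambda F) *
        (lne (sobolev_sum p F G) * lne (lne (sobolev_sum p F G))) `^ lambda)%E.
Proof.
have [B B1 hB] := @profile_bound R.
have B0 : 0 <= B by exact: le_trans ler01 B1.
have N0 : 0 < N%:R :> R by rewrite ltr0n.
pose g : R := (1 - \sum_(i < N) (p i)^-1) / N%:R.
have g_gt0 : 0 < g by rewrite divr_gt0// subr_gt0.
pose a (i : 'I_N) := (p i)^-1 + g.
have sum_a : \sum_i a i = 1.
  rewrite big_split/= sumr_const card_ord -mulr_natr divfK ?gt_eqF//.
  by rewrite addrC subrK.
pose q : R := 2^-1 `^ g.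
have q1 : 0 < 1 - q by rewrite subr_gt0 powR_half_lt1.
pose C1 := (2 * B) ^+ N * expR (g^-1).
pose C2 := (4 * B) ^+ N / (1 - q).
have C1_gt0 : 0 < C1.
  rewrite mulr_gt0 ?expR_gt0// exprn_gt0// mulr_gt0//.
  exact: lt_le_trans ltr01 B1.
have C2_ge0 : 0 <= C2 by rewrite divr_ge0 ?(ltW q1)// exprn_ge0// mulr_ge0.
exists (2 * (C1 + C2)) => F G wFG Sfin supfin.
set S := sobolev_sum p F G in Sfin *.
have [[[F0 mF0 FF0] _] _ _] := wFG (Ordinal N_gt0).
have /choice[G0 hG0] : forall i, exists G0 : 'rV[R]_N -> R,
    measurable_fun setT G0 /\ {ae lebesgue_rV R N, forall y, G i y = G0 y}.
  by move=> i; have [_ [[G0 mG0 GG0] _] _] := wFG i; exists G0.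
pose bG i := fine (normL (p i)%:E (G i)).
have bGE i : normL (p i)%:E (G i) = (bG i)%:E.
  rewrite fineK// ge0_fin_numE ?normL_ge0//.
  exact: le_lt_trans (normL_le_sobolev_sum p F G i) Sfin.
have bG_ge0 i : 0 <= bG i by rewrite fine_ge0// normL_ge0.
have := sum_derivatives_le_sobolev_sum p F G.
rewrite -/S; under eq_bigr do rewrite bGE.
rewrite sumEFin -EFinD => Sge.
pose s := fine S.
have sE : S = s%:E.
  rewrite fineK// ge0_fin_numE//; apply: le_trans Sge.
  by rewrite lee_fin addr_ge0 ?expR_ge0// sumr_ge0.
rewrite sE lee_fin in Sge.
have sum_bG_ge0 : 0 <= \sum_i bG i by exact: sumr_ge0.
have s_ge : expR 3 <= s by lra.
have s_gt0 : 0 < s by exact: lt_le_trans (expR_gt0 3) s_ge.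
(* This exponent and the scale d below make both terms of the bound on the
   averages independent of s, up to the L^r norm of F. *)
pose r := ln s.
have r_ge3 : 3 <= r by rewrite /r -[leLHS]expRK ler_ln ?posrE ?expR_gt0.
have r_gt0 : 0 < r by lra.
pose L := (r * ln r) `^ lambda.
have lnr : 2^-1 <= ln r.
  apply: (@le_trans _ _ (ln 3)); last by rewrite ler_ln ?posrE; lra.
  have : ln (3^-1 : R) <= - (2 / 3).
    have := @le_ln1Dx R (- (2 / 3)) ltac:(lra).
    by rewrite (_ : 1 + - (2 / 3) = 3^-1)//; lra.
  by rewrite lnV ?posrE//; lra.
have rlnr : 1 <= r * ln r.
  by apply: (@le_trans _ _ (3 * 2^-1)); [lra|apply: ler_pM; lra].
have L_ge1 : 1 <= L.
  rewrite -(powR1r lambda).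
  apply: ge0_ler_powR; rewrite ?nnegrE ?(ltW lambda_gt0)//.
  exact: le_trans ler01 rlnr.
have L_gt0 : 0 < L by exact: lt_le_trans ltr01 L_ge1.
have r_ge2 : 2 <= r by lra.
have r_gt1 : 1 < r by lra.
have hsup := normL_le_sup_normL lambda F r_ge2.
have sup_ge0 : (0 <= sup_normL lambda F)%E.
  apply: le_trans hsup; apply: mule_ge0; first exact: normL_ge0.
  by rewrite lee_fin invr_ge0 powR_ge0.
pose K := fine (sup_normL lambda F).
have KE : sup_normL lambda F = K%:E by rewrite fineK// ge0_fin_numE.
have K_ge0 : 0 <= K by rewrite -lee_fin -KE.
rewrite -/L KE lee_pdivrMr// -EFinM in hsup.
pose bF := fine (normL r%:E F).
have bFE : normL r%:E F = bF%:E.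
  by rewrite fineK// ge0_fin_numE ?normL_ge0//; apply: le_lt_trans hsup (ltry _).
have bF_ge0 : 0 <= bF by rewrite fine_ge0// normL_ge0.
rewrite bFE lee_fin in hsup.
pose m := Num.max 1 K.
have m_ge1 : 1 <= m by rewrite le_max lexx.
have Km : K <= m by rewrite le_max lexx orbT.
pose M := (C1 + C2) * m * L.
have M_gt0 : 0 < M.
  by rewrite !mulr_gt0//; [rewrite ltr_pwDl|exact: lt_le_trans ltr01 m_ge1].
pose d := s `^ (- g^-1).
have d_gt0 : 0 < d by exact: powR_gt0.
have d_le1 : d <= 1.
  rewrite /d powRN invf_le1 ?powR_gt0// -(powRr0 s); apply: ler_powR.
    by apply: le_trans s_ge; rewrite -expR0 ler_expR.
  by rewrite invr_ge0 ltW.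
have dg : d `^ g = s^-1.
  by rewrite /d -powRrM mulNr mulVf ?gt_eqF// powR_inv1 ?ltW.
have dr : d `^ (- r^-1) = expR g^-1.
  rewrite /d -powRrM mulrNN /powR gt_eqF//; congr expR.
  by rewrite -/r divfK ?gt_eqF.
have bound : (2 * B) ^+ N * bF * d `^ (- r^-1) +
    (4 * B) ^+ N * (\sum_i bG i) * d `^ g / (1 - q) <= M.
  have -> : M = C1 * (m * L) + C2 * (m * L) by rewrite /M -mulrA mulrDl.
  rewrite dr dg; apply: lerD.
    rewrite mulrAC -/C1; apply: ler_wpM2l; first exact: ltW.
    by apply: le_trans hsup _; apply: ler_wpM2r => //; exact: ltW.
  rewrite -[X in X / _]mulrA mulrAC -/C2; apply: ler_wpM2l => //.
  apply: (@le_trans _ _ 1).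
    by rewrite ler_pdivrMr// mul1r; have := expR_ge0 (3 : R); lra.
  by rewrite -[leLHS]mulr1; apply: ler_pM.
have aeF : {ae lebesgue_rV R N, forall y, `|F0 y| <= 2 * M}.
  apply: (@ae_bound_dilation _ _ B p r F0 G0 bF bG B1 hB p_gt1 r_gt1 mF0 _ _ _ _
    a g g_gt0 _ sum_a bG_ge0 d M) => //.
  - by move=> i; case: (hG0 i).
  - by rewrite -bFE; exact: normL_ae_eq.
  - by move=> i; rewrite -bGE; have [? ?] := hG0 i; exact: normL_ae_eq.
  - move=> i f sf tf; have [? ?] := hG0 i.
    exact: (weak_pderiv_Borel (wFG i)).
have M2_ge0 : 0 <= 2 * M by rewrite mulr_ge0// ltW.
apply: le_trans (normL_le_ess_bound FF0 aeF M2_ge0) _.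
rewrite sE KE lne_EFin// lne_EFin// -EFinM poweR_EFin -EFin_max -!EFinM lee_fin.
by rewrite /M !mulrA.
Qed.
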